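(* (Odd part.) For $h\in\mathbb N_0$, the polynomial symplectic spinors of homogeneity $h$ in the variables $z,\bar z$ and odd in $q$, $$s_{o,k}^h=\sum_{p=0}^h\sqrt{\frac{(2k+2p)!!}{(2k+2p+1)!!}}\binom hp\psi_{2k+2p+1}(q)\,\bar z^{h-p}z^p,\qquad k\in\mathbb N_0,$$ form a (topological) basis of the odd part of the homogeneity $h$ solution space $M_h^s$ of the symplectic Dirac operator $D_s$. (Even part.) For $h\in\mathbb N_0$, the polynomial symplectic spinors of homogeneity $h$ in $z,\bar z$ and even in $q$, given for $k\in\mathbb N_0$ by $$s_{e,k}^h=\sum_{p=0}^h\sqrt{\frac{(2k+2p-1)!!}{(2k+2p)!!}}\binom hp\psi_{2k+2p}(q)\,\bar z^{h-p}z^p,$$ and for $k=-1,-2,\dots,-h$ by $$s_{e,k}^h=\sum_{p=|k|}^h\sqrt{\frac{(2k+2p-1)!!}{(2k+2p)!!}}\binom hp\psi_{2k+2p}(q)\,\bar z^{h-p}z^p,$$ form a (topological) basis of the even part of $M_h^s$. Consequently, running over all $h\in\mathbb N_0$, these elements form a (topological) basis of $\mathrm{Ker}(D_s)$ in $\mathrm{Pol}(\mathbb R^2,\mathbb C)\otimes\mathcal S(\mathbb R)$.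
   Context: Let $(x,y)\in\mathbb R^2$, $z=x+\mathrm{i}y$, $\bar z=x-\mathrm{i}y$, $q\in\mathbb R$, and let $\mathcal S(\mathbb R)$ be the Schwartz space in $q$. The symplectic Dirac operator is $D_s=\mathrm{i}q\partial_y-\partial_x\partial_q=-(q+\partial_q)\partial_z+(q-\partial_q)\partial_{\bar z}$ on $\mathrm{Pol}(\mathbb R^2,\mathbb C)\otimes\mathcal S(\mathbb R)$, and $M_h^s=(\mathrm{Pol}_h(\mathbb R^2,\mathbb C)\otimes\mathcal S(\mathbb R))\cap\mathrm{Ker}(D_s)$, where $\mathrm{Pol}_h$ denotes homogeneous polynomials of degree $h$. The odd (even) part consists of elements odd (even) in $q$. Hermite functions: $\psi_k(q)=\frac{(-1)^k}{\sqrt{2^kk!\sqrt\pi}}\,e^{q^2/2}\frac{d^k}{dq^k}e^{-q^2}$, i.e. $\psi_k=\frac{1}{\sqrt{2^kk!\sqrt\pi}}e^{-q^2/2}H_k(q)$ with $H_k$ the $k$-th (physicists') Hermite polynomial; they satisfy $(q+\partial_q)\psi_k=\sqrt{2k}\,\psi_{k-1}$ and $(q-\partial_q)\psi_k=\sqrt{2(k+1)}\,\psi_{k+1}$, and $\{\psi_k\}_{k\in\mathbb N_0}$ is a (topological) basis of $\mathcal S(\mathbb R)$. Double factorials with $(-1)!!=0!!=1$. ''(Topological) basis'' means linearly independent with dense linear span, where $\mathrm{Pol}_h(\mathbb R^2,\mathbb C)\otimes\mathcal S(\mathbb R)\cong\mathcal S(\mathbb R)^{h+1}$ carries the Fréchet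 topology, and $\mathrm{Ker}(D_s)=\bigoplus_hM_h^s$. *)

(* Defs.v *)
From HB Require Import structures.
From mathcomp Require Import all_boot all_order all_algebra.
From mathcomp Require Import all_classical all_reals all_analysis.
From mathcomp Require Export complex.
Set Implicit Arguments.
Unset Strict Implicit.
Unset Printing Implicit Defensive.
Import Order.TTheory GRing.Theory Num.Theory numFieldNormedType.Exports.
Local Open Scope classical_set_scope.
Local Open Scope complex_scope.
Local Open Scope ring_scope.

Section ComplexValued.
Variable R : realType.
Local Notation C := R[i].

(* The library has no R-normed module structure on R[i], so the derivative of
   a complex-valued function of a real variable is taken componentwise. *)
Definition cderiv (f : R -> C) (t : R) : C :=
  (derive1 (fun s => complex.Re (f s)) t) +i* (derive1 (fun s => complex.Im (f s)) t).

Definition cderivn (n : nat) (f : R -> C) : R -> C := iter n cderiv f.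

Definition smoothC (f : R -> C) : Prop := forall n t,
  derivable (fun s => complex.Re (cderivn n f s)) t 1 /\
  derivable (fun s => complex.Im (cderivn n f s)) t 1.

Definition schwartz_norm (a b : nat) (f : R -> C) : \bar R :=
  ereal_sup [set (`|q| ^+ a * Normc.normc (cderivn b f q))%:E | q in setT].

Definition schwartz (f : R -> C) : Prop :=
  smoothC f /\ forall a b, (schwartz_norm a b f < +oo)%E.

Definition hermite_fun (k : nat) (q : R) : R :=
  (-1) ^+ k / Num.sqrt (2 ^+ k * k`!%:R * Num.sqrt pi) *
  expR (q ^+ 2 / 2) * derive1n k (fun t => expR (- t ^+ 2)) q.

End ComplexValued.

Section Spinors.
Variable R : realType.
Local Notation C := R[i].

(* Functions of (x, y, q). *)
Definition spinor : Type := R -> R -> R -> C^o.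
HB.instance Definition _ := GRing.Lmodule.copy spinor (R -> R -> R -> C^o).

Definition pol_spinor (n : nat) (c : nat -> nat -> R -> C) : spinor :=
  fun x y q => \sum_(i < n) \sum_(j < n) (x ^+ i * y ^+ j)%:C * c i j q.

(* Pol(R^2, C) (x) S(R) *)
Definition Pol_S : set spinor :=
  [set u | exists n c, (forall i j, schwartz (c i j)) /\ u = pol_spinor n c].

(* Pol_h(R^2, C) (x) S(R) *)
Definition Polh_S (h : nat) : set spinor :=
  [set u | exists c : nat -> R -> C, (forall i, schwartz (c i)) /\
     u = fun x y q => \sum_(i < h.+1) (x ^+ i * y ^+ (h - i))%:C * c i q].

Definition dx (u : spinor) : spinor := fun x y q => cderiv (fun t => u t y q) x.
Definition dy (u : spinor) : spinor := fun x y q => cderiv (fun t => u x t q) y.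
Definition dq (u : spinor) : spinor := fun x y q => cderiv (fun t => u x y t) q.

Definition Dirac (u : spinor) : spinor :=
  fun x y q => 'i * q%:C * dy u x y q - dx (dq u) x y q.

Definition Ker_Dirac : set spinor := [set u | Pol_S u /\ Dirac u = 0].
Definition monogenic (h : nat) : set spinor := Polh_S h `&` Ker_Dirac.

Definition odd_in_q : set spinor :=
  [set u | forall x y q, u x y (- q) = - u x y q].
Definition even_in_q : set spinor :=
  [set u | forall x y q, u x y (- q) = u x y q].

(* Basic neighbourhoods of 0 in Pol (x) S, seen as the direct sum of copies of
   the Frechet space S(R) indexed by the monomials x^i y^j. For such a countable
   direct sum the locally convex direct sum topology is the box topology: the
   order N and the radius e of the seminorm ball may vary with (i, j). *)
Definition spinor_ball (N : nat -> nat -> nat) (e : nat -> nat -> R) :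
    set spinor :=
  [set u | exists n c,
     [/\ forall i j, schwartz (c i j),
         forall i j a b, (a <= N i j)%N -> (b <= N i j)%N ->
           (schwartz_norm a b (c i j) < (e i j)%:E)%E
       & u = pol_spinor n c]].

(* The translates of these balls. In the resulting topology on the ambient
   function space, Pol_S is an open subgroup carrying the locally convex direct
   sum topology, and each Polh_S h carries the Frechet topology of S(R)^(h+1).
   Only subsets of Pol_S are considered below. *)
Definition nbhs_spinor (u : spinor) : set (set spinor) :=
  [set A | exists N e, (forall i j, 0 < e i j) /\
     forall v, spinor_ball N e (v - u) -> A v].

Lemma cderivnD (f g : R -> C) n : smoothC f -> smoothC g ->
  cderivn n (fun t => f t + g t) = (fun t => cderivn n f t + cderivn n g t).
Proof.
move=> sf sg; elim: n => //= n; rewrite /cderivn /= => ->.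
apply/funext => t; rewrite {1}/cderiv.
have [f1 f2] := sf n t; have [g1 g2] := sg n t.
have E1 : (fun s => complex.Re (iter n (@cderiv R) f s + iter n (@cderiv R) g s)) =
  (fun s => complex.Re (iter n (@cderiv R) f s)) + (fun s => complex.Re (iter n (@cderiv R) g s)).
  by apply/funext => s; rewrite raddfD.
have E2 : (fun s => complex.Im (iter n (@cderiv R) f s + iter n (@cderiv R) g s)) =
  (fun s => complex.Im (iter n (@cderiv R) f s)) + (fun s => complex.Im (iter n (@cderiv R) g s)).
  by apply/funext => s; rewrite raddfD.
by rewrite E1 E2 !derive1E !deriveD // -!derive1E.
Qed.

Lemma smoothCD (f g : R -> C) :
  smoothC f -> smoothC g -> smoothC (fun t => f t + g t).
Proof.
move=> sf sg n t; rewrite cderivnD//.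
have [f1 f2] := sf n t; have [g1 g2] := sg n t; split.
  rewrite (_ : (fun s => _) = (fun s => complex.Re (cderivn n f s)) +
    (fun s => complex.Re (cderivn n g s))); first exact: derivableD.
  by apply/funext => s; rewrite raddfD.
rewrite (_ : (fun s => _) = (fun s => complex.Im (cderivn n f s)) +
  (fun s => complex.Im (cderivn n g s))); first exact: derivableD.
by apply/funext => s; rewrite raddfD.
Qed.

Lemma schwartz_normD (f g : R -> C) a b : smoothC f -> smoothC g ->
  (schwartz_norm a b (fun t => f t + g t)%R <=
   schwartz_norm a b f + schwartz_norm a b g)%E.
Proof.
move=> sf sg; apply: ge_ereal_sup => _ [q _ <-]; rewrite cderivnD//.
apply: (@le_trans _ _ ((`|q| ^+ a * Normc.normc (cderivn b f q))%:E +
   (`|q| ^+ a * Normc.normc (cderivn b g q))%:E)%E).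
  rewrite -EFinD lee_fin -mulrDr ler_wpM2l ?exprn_ge0//.
  exact: le_normcD.
by apply: leeD; apply: ereal_sup_ubound; exists q.
Qed.

Lemma schwartzD (f g : R -> C) :
  schwartz f -> schwartz g -> schwartz (fun t => f t + g t).
Proof.
move=> [sf nf] [sg ng]; split; first exact: smoothCD.
move=> a b; apply: le_lt_trans (schwartz_normD _ _ sf sg) _.
exact: lte_add_pinfty.
Qed.

Lemma cderivn0 n : cderivn n (fun=> 0 : C) = (fun=> 0).
Proof.
elim: n => //= n; rewrite /cderivn /= => ->.
by apply/funext => t; rewrite /cderiv /= !derive1_cst.
Qed.

Lemma schwartz_norm0 a b : schwartz_norm a b (fun=> 0 : C) = 0%E.
Proof.
rewrite /schwartz_norm cderivn0.
rewrite (_ : [set _ | q in setT] = [set 0%E]) ?ereal_sup1//.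
apply/seteqP; split => [_ [q _ <-]|_ ->] /=; last exists 0 => //;
  by rewrite expr0n /= addr0 sqrtr0 mulr0.
Qed.

Lemma schwartz0 : schwartz (fun=> 0 : C).
Proof.
split=> [n t|a b]; last by rewrite schwartz_norm0 ltry.
by rewrite cderivn0; split; exact: derivable_cst.
Qed.

Lemma pol_spinor_pad n m (c : nat -> nat -> R -> C) : (n <= m)%N ->
  pol_spinor n c =
  pol_spinor m (fun i j => if (i < n)%N && (j < n)%N then c i j else fun=> 0).
Proof.
move=> nm; apply/funext => x; apply/funext => y; apply/funext => q.
rewrite /pol_spinor.
rewrite (big_ord_widen m (fun i => \sum_(j < n) (x ^+ i * y ^+ j)%:C * c i j q))//.
rewrite big_mkcond /=; apply: eq_bigr => i _; case: ifPn => /= _; last first.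
  by rewrite big1// => j _; rewrite mulr0.
rewrite (big_ord_widen m (fun j => (x ^+ i * y ^+ j)%:C * c i j q))//.
rewrite big_mkcond /=; apply: eq_bigr => j _.
by case: ifPn => //= _; rewrite mulr0.
Qed.

Lemma spinor_ball_pad N (e : nat -> nat -> R) n m c :
  (forall i j, 0 < e i j) -> (n <= m)%N ->
  (forall i j, schwartz (c i j)) ->
  (forall i j a b, (a <= N i j)%N -> (b <= N i j)%N ->
     (schwartz_norm a b (c i j) < (e i j)%:E)%E) ->
  exists c', [/\ forall i j, schwartz (c' i j),
     forall i j a b, (a <= N i j)%N -> (b <= N i j)%N ->
       (schwartz_norm a b (c' i j) < (e i j)%:E)%E
     & pol_spinor n c = pol_spinor m c'].
Proof.
move=> e0 nm sc cN.
exists (fun i j => if (i < n)%N && (j < n)%N then c i j else fun=> 0).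
split; last exact: pol_spinor_pad nm.
  by move=> i j; case: ifP => // _; exact: schwartz0.
move=> i j a b aN bN; case: ifP => // _; first exact: cN.
by rewrite schwartz_norm0 lte_fin.
Qed.

Lemma spinor_ballD N (e : nat -> nat -> R) u v : (forall i j, 0 < e i j) ->
  spinor_ball N (fun i j => e i j / 2) u ->
  spinor_ball N (fun i j => e i j / 2) v -> spinor_ball N e (u + v).
Proof.
move=> e0; have e2 i j : 0 < e i j / 2 by rewrite divr_gt0.
move=> [n [c [sc cN ->]]] [m [d [sd dN ->]]].
have [c' [sc' cN' ->]] := spinor_ball_pad e2 (leq_maxl n m) sc cN.
have [d' [sd' dN' ->]] := spinor_ball_pad e2 (leq_maxr n m) sd dN.
exists (maxn n m), (fun i j t => c' i j t + d' i j t); split.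
- by move=> i j; exact: schwartzD.
- move=> i j a b aN bN.
  apply: le_lt_trans (schwartz_normD _ _ (sc' i j).1 (sd' i j).1) _.
  rewrite (_ : e i j = e i j / 2 + e i j / 2); last exact: splitr.
  by rewrite EFinD; apply: lteD; [exact: cN'|exact: dN'].
- apply/funext => x; apply/funext => y; apply/funext => q.
  transitivity (pol_spinor (maxn n m) c' x y q + pol_spinor (maxn n m) d' x y q).
    by [].
  rewrite /pol_spinor -big_split /=; apply: eq_bigr => i _.
  by rewrite -big_split /=; apply: eq_bigr => j _; rewrite -mulrDr.
Qed.

Lemma spinor_ball0 N (e : nat -> nat -> R) : (forall i j, 0 < e i j) ->
  spinor_ball N e 0.
Proof.
move=> e0; exists 0%N, (fun _ _ _ => 0); split.
- by move=> i j; exact: schwartz0.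
- by move=> i j a b _ _; rewrite schwartz_norm0 lte_fin.
- apply/funext => x; apply/funext => y; apply/funext => q.
  by rewrite /pol_spinor big_ord0.
Qed.

Lemma nbhs_spinor_filter u : ProperFilter (nbhs_spinor u).
Proof.
split.
  move=> [N [e [e0 /(_ u)]]]; apply.
  by rewrite subrr; exact: spinor_ball0.
split.
- by exists (fun _ _ => 0%N), (fun _ _ => 1).
- move=> A B [N [e [e0 NA]]] [M [d [d0 MB]]].
  exists (fun i j => maxn (N i j) (M i j)), (fun i j => Num.min (e i j) (d i j)).
  split=> [i j|v [n [c [sc cN cE]]]]; first by rewrite lt_min e0 d0.
  split; [apply: NA|apply: MB]; exists n, c; split=> // i j a b ai bi.
    have := cN i j a b (leq_trans ai (leq_maxl _ _)) (leq_trans bi (leq_maxl _ _)).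
    by move=> /lt_le_trans; apply; rewrite lee_fin ge_min lexx.
  have := cN i j a b (leq_trans ai (leq_maxr _ _)) (leq_trans bi (leq_maxr _ _)).
  by move=> /lt_le_trans; apply; rewrite lee_fin ge_min lexx orbT.
- by move=> A B AB [N [e [e0 NA]]]; exists N, e; split=> // v /NA /AB.
Qed.

Lemma nbhs_spinor_singleton u (A : set spinor) : nbhs_spinor u A -> A u.
Proof. by move=> [N [e [e0]]]; apply; rewrite subrr; exact: spinor_ball0. Qed.

Lemma nbhs_spinor_nbhs u (A : set spinor) :
  nbhs_spinor u A -> nbhs_spinor u (nbhs_spinor^~ A).
Proof.
move=> [N [e [e0 NA]]]; have e2 i j : 0 < e i j / 2 by rewrite divr_gt0.
exists N, (fun i j => e i j / 2); split=> // v uv.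
exists N, (fun i j => e i j / 2); split=> // w vw.
by apply: NA; rewrite -(subrKA v); exact: spinor_ballD.
Qed.

HB.instance Definition _ := hasNbhs.Build spinor nbhs_spinor.
HB.instance Definition _ := Nbhs_isNbhsTopological.Build spinor
  nbhs_spinor_filter nbhs_spinor_singleton nbhs_spinor_nbhs.

End Spinors.

Section Basis.
Variables (K : nzRingType) (E : lmodType K).

Definition linear_span (I : Type) (b : I -> E) : set E :=
  [set u | exists (s : seq I) (c : I -> K), u = \sum_(i <- s) c i *: b i].

Definition linearly_independent (I : eqType) (b : I -> E) : Prop :=
  forall (s : seq I) (c : I -> K), uniq s ->
    \sum_(i <- s) c i *: b i = 0 -> {in s, forall i, c i = 0}.

End Basis.

Definition topological_basis (R : realType) (V : set (spinor R)) (I : eqType)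
    (b : I -> spinor R) : Prop :=
  [/\ forall i, V (b i), linearly_independent b & V `<=` closure (linear_span b)].

Section Solutions.
Variable R : realType.

Fixpoint dfactn (n : nat) : nat := if n is m.+2 then (n * dfactn m)%N else 1%N.

(* Double factorial; the only negative argument that occurs is -1. *)
Definition dfact (m : int) : nat := if m is Posz n then dfactn n else 1%N.

Definition zpol (h p : nat) (x y : R) : R[i] :=
  (x -i* y) ^+ (h - p) * (x +i* y) ^+ p.

Definition s_odd (h k : nat) : spinor R := fun x y q =>
  \sum_(0 <= p < h.+1)
    (Num.sqrt ((dfact (2 * k + 2 * p)%N)%:R / (dfact (2 * k + 2 * p + 1)%N)%:R)
     * 'C(h, p)%:R * hermite_fun (2 * k + 2 * p + 1) q)%:C * zpol h p x y.

(* k ranges over the integers >= -h; all indices 2k+2p that occur are >= 0. *)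
Definition s_even (h : nat) (k : int) : spinor R := fun x y q =>
  \sum_((if (0 <= k)%R then 0 else `|k|)%N <= p < h.+1)
    (Num.sqrt ((dfact (2 * k + 2 * p%:Z - 1))%:R / (dfact (2 * k + 2 * p%:Z))%:R)
     * 'C(h, p)%:R * hermite_fun `|2 * k + 2 * p%:Z| q)%:C * zpol h p x y.

Definition even_index (h : nat) : Type := {k : int | - h%:Z <= k}.

Definition s_all (i : {h : nat & (nat + even_index h)%type}) : spinor R :=
  match tagged i with
  | inl k => s_odd (tag i) k
  | inr k => s_even (tag i) (val k)
  end.

End Solutions.

(* Main.v *)
Require Import Defs.
From mathcomp Require Import all_boot all_order all_algebra.
From mathcomp Require Import all_classical all_reals all_analysis.
From mathcomp Require Import measurable_realfun ring lra zify.
Set Implicit Arguments.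
Unset Strict Implicit.
Unset Printing Implicit Defensive.
Import Order.TTheory GRing.Theory Num.Theory numFieldNormedType.Exports.
Local Open Scope classical_set_scope.
Local Open Scope complex_scope.
Local Open Scope ring_scope.

(* Writing u = sum_p f_p(q) zbar^(h-p) z^p, the equation D_s u = 0 becomes the
   chain (p+1) A f_(p+1) = (h-p) A* f_p with the ladder operators A = q + d/dq
   and A* = q - d/dq; its coefficients are real, so real and imaginary parts of
   the f_p can be treated separately. In Hermite coefficients the chain couples
   index n of f_p only to index n + 2 of f_(p+1), and each chain of coefficients
   that can be nonzero is a multiple of one of the spinors of the theorem. A
   chain is named here by (h, N), where N is its Hermite index in f_h.

   Density reduces to the convergence of Hermite expansions in S(R). Since A
   and A* map partial sums to partial sums, L^2 convergence for every Schwartz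
   function suffices (Sobolev's inequality then gives the seminorms), and this
   follows from the spectral gap |A f|^2 >= 2m |f|^2 for f orthogonal to the
   first m Hermite functions. *)

(** * Derivatives and rapid decay *)

Section RapidDecay.
Variable R : realType.
Implicit Types (f g u F G : R -> R).

(** The spectral gap is usually read off from the completeness of the Hermite functions; here it has
    to come before it. What replaces completeness is that every Schwartz function orthogonal to the
    Gaussian is [raise g] for some Schwartz [g], which lowers the level by one, while the commutator
    [A A* - A* A = 2] supplies a gain of 2 at each level. Applied to a remainder [r] of [f], the gap
    bounds [2m |r|^2] by [|A f|^2], so the smoothness of [f] turns into decay of [r].

    Truncation follows the chains: [f_p] is cut at a Hermite index shifted by [2 (h - p)], so that
    partial sums remain combinations of exact solutions. A neighbourhood may use a different
    seminorm at each monomial, but a given solution involves finitely many monomials, and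
    convergence in each seminorm is then enough. *)

Definition deriv f g := forall x : R, is_derive x 1 f (g x).

Lemma derivE f g : deriv f g -> (derive1 f) = g.
Proof. by move=> fg; apply/funext => x; rewrite derive1E; exact: derive_val. Qed.

Lemma deriv_derive1 f : (forall x, derivable f x 1) -> deriv f (derive1 f).
Proof. by move=> df x; rewrite derive1E; exact: derivableP. Qed.

Lemma deriv_derivable f g : deriv f g -> forall x, derivable f x 1.
Proof. by move=> fg x; exact: ex_derive. Qed.

Lemma eq_deriv f g g' : g =1 g' -> deriv f g -> deriv f g'.
Proof. by move=> /funext ->. Qed.

Lemma deriv_ext f f' g g' : f =1 g -> f' =1 g' -> deriv f f' -> deriv g g'.
Proof. by move=> /funext -> /funext ->. Qed.

Lemma derivC (c : R) : deriv (fun=> c) (fun=> 0).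
Proof. by move=> x; exact: is_derive_cst. Qed.

Lemma deriv_id : deriv (fun x => x) (fun=> 1).
Proof. by move=> x; exact: is_derive_id. Qed.

Lemma derivD f f' g g' : deriv f f' -> deriv g g' ->
  deriv (fun x => f x + g x) (fun x => f' x + g' x).
Proof. by move=> df dg x; exact: is_deriveD. Qed.

Lemma derivN f f' : deriv f f' -> deriv (fun x => - f x) (fun x => - f' x).
Proof. by move=> df x; exact: is_deriveN. Qed.

Lemma derivB f f' g g' : deriv f f' -> deriv g g' ->
  deriv (fun x => f x - g x) (fun x => f' x - g' x).
Proof. by move=> df dg x; exact: is_deriveB. Qed.

Lemma derivZ (c : R) f f' : deriv f f' ->
  deriv (fun x => c * f x) (fun x => c * f' x).
Proof. by move=> df x; exact: (is_deriveZ c). Qed.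

Lemma derivM f f' g g' : deriv f f' -> deriv g g' ->
  deriv (fun x => f x * g x) (fun x => f' x * g x + f x * g' x).
Proof.
move=> df dg x; apply: is_derive_eq; first exact: (@is_deriveM _ _ f g).
by rewrite addrC /GRing.scale /= (mulrC (g x)).
Qed.

Lemma deriv_comp f f' g g' : deriv f f' -> deriv g g' ->
  deriv (fun x => f (g x)) (fun x => f' (g x) * g' x).
Proof. by move=> df dg x; exact: is_derive1_comp. Qed.

Lemma deriv_expR f f' : deriv f f' ->
  deriv (fun x => expR (f x)) (fun x => f' x * expR (f x)).
Proof.
move=> df; apply: eq_deriv (deriv_comp (@is_derive_expR R) df) => x.
exact: mulrC.
Qed.

Lemma deriv_opp f f' : deriv f f' -> deriv (fun x => f (- x)) (fun x => - f' (- x)).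
Proof.
move=> df; apply: eq_deriv (deriv_comp df (derivN deriv_id)) => x.
by rewrite mulrN1.
Qed.

Lemma deriv_cst f : deriv f (fun=> 0) -> forall x y, f x = f y.
Proof. by move=> df x y; exact: is_derive_0_is_cst. Qed.

Lemma deriv_continuous f g : deriv f g -> continuous f.
Proof.
move=> df x; apply: differentiable_continuous; apply/derivable1_diffP.
exact: deriv_derivable df x.
Qed.

Lemma deriv_ge0_le F u (a : R) : deriv F u -> (forall x, a <= x -> 0 <= u x) ->
  forall x y, a <= x -> x <= y -> F x <= F y.
Proof.
move=> dF u0 x y ax xy; apply: (@ger0_derive1_ndecr _ F x y) => //.
- by move=> z _; exact: deriv_derivable dF z.
- move=> z; rewrite in_itv /= => /andP[xz _].
  by rewrite (derivE dF) u0// (le_trans ax)// ltW.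
- by apply: continuous_subspaceT; exact: deriv_continuous dF.
Qed.

Lemma deriv_nondecreasing F u : deriv F u -> (forall x, 0 <= u x) ->
  {homo F : x y / x <= y}.
Proof. by move=> dF u0 x y xy; apply: (deriv_ge0_le dF _ (lexx x)). Qed.

Definition rapid u := forall a, exists M : R, forall x, `|x| ^+ a * `|u x| <= M.

Lemma rapidD f g : rapid f -> rapid g -> rapid (fun x => f x + g x).
Proof.
move=> rf rg a; have [M fM] := rf a; have [N gN] := rg a.
exists (M + N) => x; apply: le_trans (lerD (fM x) (gN x)).
by rewrite -mulrDr ler_wpM2l ?exprn_ge0 ?ler_normD.
Qed.

Lemma rapidZ (c : R) f : rapid f -> rapid (fun x => c * f x).
Proof.
move=> rf a; have [M fM] := rf a; exists (`|c| * M) => x.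
by rewrite normrM mulrCA ler_wpM2l.
Qed.

Lemma rapid_mulx f : rapid f -> rapid (fun x => x * f x).
Proof.
move=> rf a; have [M fM] := rf a.+1; exists M => x.
by rewrite normrM mulrA -exprSr.
Qed.

Lemma rapidM f g : rapid f -> rapid g -> rapid (fun x => f x * g x).
Proof.
move=> rf rg a; have [M fM] := rf a; have [N gN] := rg 0%N.
exists (M * N) => x; rewrite normrM mulrA ler_pM//.
by have := gN x; rewrite expr0 mul1r.
Qed.

Lemma le_rapid f g : rapid g -> (forall x, `|f x| <= `|g x|) -> rapid f.
Proof.
move=> rg fg a; have [M gM] := rg a; exists M => x.
by apply: le_trans (gM x); rewrite ler_wpM2l ?exprn_ge0.
Qed.

Lemma rapid_opp f : rapid f -> rapid (fun x => f (- x)).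
Proof.
by move=> rf a; have [M fM] := rf a; exists M => x; have := fM (- x); rewrite normrN.
Qed.

(** With [n = 1] this dominates [f] by a multiple of [1 / (1 + x^2)], the derivative of [atan];
    integrability and the existence of limits at infinity both rest on that. The induction passes
    from [f] to [f + x^2 f]. *)
Lemma rapid_oneDsqr f n : rapid f ->
  exists M : R, 0 <= M /\ forall x, `|f x| * (1 + x ^+ 2) ^+ n <= M.
Proof.
elim: n f => [|n IHn] f rf.
  have [M fM] := rf 0%N; exists M; split.
    by apply: le_trans (fM 0); apply: mulr_ge0; rewrite ?exprn_ge0.
  by move=> x; have := fM x; rewrite !expr0 mul1r mulr1.
have [M [M0 fM]] := IHn _ (rapidD rf (rapid_mulx (rapid_mulx rf))).
exists M; split=> // x; apply: le_trans (fM x).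
rewrite (exprS (1 + x ^+ 2)) (mulrA `|f x|) ler_wpM2r// ?exprn_ge0 ?addr_ge0 ?sqr_ge0//.
rewrite [X in _ <= `|X|](_ : _ = f x * (1 + x ^+ 2)); last by ring.
by rewrite normrM (ger0_norm (_ : 0 <= 1 + x ^+ 2)) ?addr_ge0 ?sqr_ge0.
Qed.

Lemma rapid_cvgy f : rapid f -> f x @[x --> +oo] --> (0 : R).
Proof.
move=> /(_ 1%N)[M fM]; apply/cvgrPdist_le => e e0; near=> x.
have x0 : 0 < x by near: x; apply: nbhs_pinfty_gt; rewrite num_real.
rewrite sub0r normrN -(ler_pM2l x0).
apply: le_trans (_ : M <= _).
  by have := fM x; rewrite expr1 (gtr0_norm x0).
rewrite -ler_pdivrMr//; near: x; apply: nbhs_pinfty_ge; exact: num_real.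
Unshelve. all: by end_near. Qed.

Lemma cvgNy_opp F (l : R) : F (- x) @[x --> +oo] --> l -> F x @[x --> -oo] --> l.
Proof.
by move=> /(cvgNy_compNP _ _).2 /=.
Qed.

Lemma rapid_cvgNy f : rapid f -> f x @[x --> -oo] --> (0 : R).
Proof.
by move=> rf; apply: cvgNy_opp; apply: rapid_cvgy; exact: rapid_opp.
Qed.

End RapidDecay.

(** * Improper integrals over the line *)

Section ImproperIntegral.
Variable R : realType.
Implicit Types (f g u F G : R -> R).

Let oneDsqr_gt0 (x : R) : 0 < oneDsqr x.
Proof. exact: lt_le_trans ltr01 (oneDsqr_ge1 x). Qed.

Lemma continuous_rapid_integrable u : continuous u -> rapid u ->
  (@lebesgue_measure R).-integrable setT (EFin \o u).
Proof.
move=> cu ru; have [M [M0 uM]] := rapid_oneDsqr 1 ru.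
have i1 : (@lebesgue_measure R).-integrable setT
    (EFin \o (fun x : R => (oneDsqr x)^-1)).
  apply/integrableP; split.
    apply/measurable_EFinP; apply: continuous_measurable_fun.
    exact: continuous_oneDsqrV.
  rewrite (_ : (fun x => _) = (fun x : R => ((oneDsqr x)^-1)%:E)); last first.
    by apply/funext => x /=; rewrite ger0_norm ?invr_ge0 ?ltW ?oneDsqr_gt0.
  rewrite ge0_symfun_integralT//=.
  - rewrite (_ : [set x | _] = `[0, +oo[%classic); last first.
      by apply/seteqP; split => x/=; rewrite in_itv/= andbT.
    by rewrite integral0y_oneDsqr -EFinM ltry.
  - exact: continuous_oneDsqrV.
  - by move=> x/=; rewrite /oneDsqr sqrrN.
apply: (@le_integrable _ _ R lebesgue_measure setT measurableT (EFin \o u)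
    (EFin \o (fun x : R => M * (oneDsqr x)^-1))).
- by apply/measurable_EFinP; exact: continuous_measurable_fun.
- move=> x _ /=; rewrite lee_fin.
  rewrite (ger0_norm (divr_ge0 M0 (ltW (oneDsqr_gt0 x)))).
  by rewrite ler_pdivlMr ?oneDsqr_gt0//; have := uM x; rewrite expr1.
- rewrite (_ : EFin \o _ = fun x : R => M%:E * (oneDsqr x)^-1%:E)%E.
    exact: integrableZl.
  by apply/funext => x /=; rewrite EFinM.
Qed.

(** Since [|u|] is at most [M] times the derivative of [atan], both [F + M atan] and [M atan - F]
    are nondecreasing. The second bounds the first from above, so [F + M atan] converges, and [F]
    with it. *)
Lemma deriv_cvgy F u : deriv F u -> rapid u -> cvg (F x @[x --> +oo]).
Proof.
move=> dF ru; have [M [M0 uM]] := rapid_oneDsqr 1 ru.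
have uM' x : `|u x| <= M * (1 + x ^+ 2)^-1.
  by rewrite ler_pdivlMr ?oneDsqr_gt0// -[X in _ * X]expr1.
have datan : deriv (@atan R) (fun x => (1 + x ^+ 2)^-1).
  by move=> x; exact: is_derive1_atan.
have dG := derivD dF (derivZ M datan).
have dH := derivB (derivZ M datan) dF.
have ndG : {homo (fun x => F x + M * atan x) : x y / x <= y}.
  apply: (deriv_nondecreasing dG) => x; rewrite -lerBlDr sub0r.
  by have := uM' x; rewrite ler_norml => /andP[].
have ndH : {homo (fun x => M * atan x - F x) : x y / x <= y}.
  apply: (deriv_nondecreasing dH) => x; rewrite subr_ge0.
  by have := uM' x; rewrite ler_norml => /andP[].
have MG x : M * atan x <= M * (pi / 2) by rewrite ler_wpM2l// ltW// atan_ltpi2.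
have ub : has_ubound (range (fun x => F x + M * atan x)).
  exists (F 0 + M * (pi / 2) + M * (pi / 2)) => _ [x _ <-].
  have x0 : x <= Num.max x 0 by rewrite le_max lexx.
  have m0 : 0 <= Num.max x 0 by rewrite le_max lexx orbT.
  apply: le_trans (ndG _ _ x0) _.
  move: (ndH _ _ m0) (MG (Num.max x 0)); rewrite /= atan0 mulr0.
  set m := Num.max x 0; set a := M * atan m; set b := M * _; lra.
have := nondecreasing_cvgr ndG ub; set s := sup _ => cG.
apply/cvg_ex; exists (s - M * (pi / 2)).
rewrite (_ : F = (fun x => F x + M * atan x - M * atan x)); last first.
  by apply/funext => x; rewrite addrK.
by apply: (cvgB cG); apply: cvgMl_tmp; exact: cvgy_atan.
Qed.

Lemma deriv_cvgNy F u : deriv F u -> rapid u -> cvg (F x @[x --> -oo]).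
Proof.
move=> dF ru; have dG := derivN (deriv_opp dF).
have rG : rapid (fun x => - - u (- x)).
  by apply: le_rapid (rapid_opp ru) _ => x; rewrite opprK.
have /cvg_ex[l cG] := deriv_cvgy dG rG; apply/cvg_ex; exists (- l).
apply: cvgNy_opp; rewrite (_ : (fun x => _) = (fun x => - - F (- x))).
  exact: cvgN.
by apply/funext => x; rewrite opprK.
Qed.

(** Stated through an antiderivative, so that linearity, reflection, positivity and integration by
    parts become facts about derivatives and limits. Lebesgue integration serves only to produce [F]
    in [integral_exists]. *)
Definition integral_is u (v : R) := exists F,
  [/\ deriv F u, F x @[x --> -oo] --> (0 : R) & F x @[x --> +oo] --> v].

Lemma integral_exists u : continuous u -> rapid u -> exists v, integral_is u v.
Proof.
move=> cu ru; have iu := continuous_rapid_integrable cu ru.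
pose F x := \int[lebesgue_measure]_(t in `]-oo, x]) (u t).
have dF : deriv F u.
  move=> x; have xx1 : x < x + 1 by rewrite ltrDl.
  have iux : (@lebesgue_measure R).-integrable `]-oo, x + 1] (EFin \o u).
    exact: integrableS iu.
  have [dF FE] := continuous_FTC1 xx1 iux (ltNyr _) (cu x).
  by rewrite -FE derive1E; exact: derivableP.
have /cvg_ex[l Fl] := deriv_cvgy dF ru; have /cvg_ex[l' Fl'] := deriv_cvgNy dF ru.
exists (l - l'), (fun x => F x - l'); split.
- by apply: eq_deriv (derivB dF (derivC l')) => x; rewrite subr0.
- by rewrite -(subrr l'); apply: cvgB Fl' _; exact: cvg_cst.
- by apply: cvgB Fl _; exact: cvg_cst.
Qed.

Lemma integral_is_uniq u v w : integral_is u v -> integral_is u w -> v = w.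
Proof.
move=> [F [dF F0 Fv]] [G [dG G0 Gw]].
have FG x : F x - G x = F 0 - G 0.
  apply: (@deriv_cst _ (fun x => F x - G x)).
  by apply: eq_deriv (derivB dF dG) => y; rewrite subrr.
have FGE : (fun x => F x - G x) = (fun=> F 0 - G 0).
  by apply/funext => x; rewrite FG.
have cst_lim (T : set_system R) (l : R) : ProperFilter T ->
    (fun x => F x - G x) @ T --> l -> F 0 - G 0 = l.
  move=> PT; rewrite FGE => /(@cvg_lim _ (@Rhausdorff R)) <-.
  by rewrite lim_cst.
have := cst_lim _ _ _ (cvgB F0 G0); rewrite subr0 => FG0.
by apply/eqP; rewrite -subr_eq0 -FG0 eq_sym; apply/eqP/(cst_lim _ _ _ (cvgB Fv Gw)).
Qed.

Lemma integral_isD f g v w : integral_is f v -> integral_is g w ->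
  integral_is (fun x => f x + g x) (v + w).
Proof.
move=> [F [dF F0 Fv]] [G [dG G0 Gw]]; exists (fun x => F x + G x); split.
- exact: derivD.
- by rewrite -(addr0 0); exact: cvgD.
- exact: cvgD.
Qed.

Lemma integral_isZ (c : R) f v : integral_is f v ->
  integral_is (fun x => c * f x) (c * v).
Proof.
move=> [F [dF F0 Fv]]; exists (fun x => c * F x); split.
- exact: derivZ.
- by rewrite -(mulr0 c); exact: cvgMl_tmp.
- exact: cvgMl_tmp.
Qed.

Lemma integral_is_opp f v : integral_is f v -> integral_is (fun x => f (- x)) v.
Proof.
move=> [F [dF F0 Fv]]; exists (fun x => v - F (- x)); split.
- apply: eq_deriv (derivB (derivC v) (deriv_opp dF)) => x.
  by rewrite opprK add0r.
- rewrite -(subrr v); apply: cvgB; first exact: cvg_cst.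
  apply: (@cvgNy_opp _ (fun x => F (- x))).
  by under eq_fun do rewrite opprK.
- rewrite -[X in _ --> X]subr0; apply: cvgB; first exact: cvg_cst.
  exact/(cvgNy_compNP F _).1.
Qed.

Lemma integral_is_deriv f f' : deriv f f' -> rapid f -> integral_is f' 0.
Proof.
move=> df rf; exists f; split=> //; first exact: rapid_cvgNy.
exact: rapid_cvgy.
Qed.

Lemma nondecreasing_cvgNy_le F l : {homo F : x y / x <= y} ->
  F x @[x --> -oo] --> l -> forall x, l <= F x.
Proof.
move=> ndF Fl x; apply: (cvgr_to_le Fl); near=> y; apply: ndF.
by near: y; apply: nbhs_ninfty_le; rewrite num_real.
Unshelve. all: by end_near. Qed.

Lemma nondecreasing_cvgy_ge F l : {homo F : x y / x <= y} ->
  F x @[x --> +oo] --> l -> forall x, F x <= l.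
Proof.
move=> ndF Fl x; apply: (cvgr_to_ge Fl); near=> y; apply: ndF.
by near: y; apply: nbhs_pinfty_ge; rewrite num_real.
Unshelve. all: by end_near. Qed.

Lemma integral_is_ge0 u v : (forall x, 0 <= u x) -> integral_is u v -> 0 <= v.
Proof.
move=> u0 [F [dF F0 Fv]]; have ndF := deriv_nondecreasing dF u0.
apply: le_trans (nondecreasing_cvgNy_le ndF F0 0) _.
exact: nondecreasing_cvgy_ge.
Qed.

End ImproperIntegral.

(** * Real Schwartz functions and ladder operators *)

Section SchwartzFunctions.
Variable R : realType.
Implicit Types (f g u F G : R -> R).

(** Real-valued counterpart of [schwartz], with finite suprema replaced by explicit bounds;
    [schwartz_sch] relates the two. *)
Definition sch f := forall n,
  (forall x, derivable (derive1n n f) x 1) /\ rapid (derive1n n f).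

(* Coinduction: membership in a class of rapidly decreasing functions that is
   stable under differentiation implies being a Schwartz function. *)
Lemma sch_coind (P : (R -> R) -> Prop) f :
  (forall g, P g -> rapid g /\ exists2 g', deriv g g' & P g') -> P f -> sch f.
Proof.
move=> PP Pf n; have : P (derive1n n f).
  elim: n => // n IHn; rewrite derive1nS.
  by have [_ [g' dg Pg']] := PP _ IHn; rewrite (derivE dg).
by move=> /PP[rg [g' dg _]]; split=> //; exact: deriv_derivable dg.
Qed.

Lemma sch_rapid f : sch f -> rapid f.
Proof. by move=> /(_ 0%N)[]. Qed.

Lemma sch_deriv f : sch f -> deriv f (derive1 f).
Proof. by move=> /(_ 0%N)[df _]; exact: deriv_derive1. Qed.

Lemma sch_derive1 f : sch f -> sch (derive1 f).
Proof. by move=> sf n; rewrite -derive1Sn; exact: sf. Qed.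

Lemma sch_step f : sch f -> rapid f /\ exists2 f', deriv f f' & sch f'.
Proof.
move=> sf; split; first exact: sch_rapid.
by exists (derive1 f); [exact: sch_deriv|exact: sch_derive1].
Qed.

Lemma sch0 : sch (fun=> 0).
Proof.
apply: (@sch_coind (fun u => u = (fun=> 0))) => // _ ->; split.
  by move=> a; exists 0 => x; rewrite normr0 mulr0.
by exists (fun=> 0) => //; exact: derivC.
Qed.

Lemma schD f g : sch f -> sch g -> sch (fun x => f x + g x).
Proof.
move=> sf sg; pose P u := exists f' g', [/\ sch f', sch g' & u = fun x => f' x + g' x].
apply: (@sch_coind P); last by exists f, g.
move=> _ [{sf}f [{sg}g [sf sg ->]]]; split.
  by apply: rapidD; exact: sch_rapid.
exists (fun x => derive1 f x + derive1 g x); first by apply: derivD; exact: sch_deriv.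
by exists (derive1 f), (derive1 g); split=> //; exact: sch_derive1.
Qed.

Lemma schZ (c : R) f : sch f -> sch (fun x => c * f x).
Proof.
move=> sf; pose P u := exists2 f', sch f' & u = fun x => c * f' x.
apply: (@sch_coind P); last by exists f.
move=> _ [{sf}f sf ->]; split.
  by apply: rapidZ; exact: sch_rapid.
exists (fun x => c * derive1 f x); first by apply: derivZ; exact: sch_deriv.
by exists (derive1 f) => //; exact: sch_derive1.
Qed.

Lemma schB f g : sch f -> sch g -> sch (fun x => f x - g x).
Proof.
move=> sf sg; rewrite (_ : (fun x => _) = fun x => f x + -1 * g x).
  by apply: schD => //; exact: schZ.
by apply/funext => x; rewrite mulN1r.
Qed.

Lemma sch_sum (I : Type) (r : seq I) (P : pred I) (h : I -> R -> R) :
  (forall i, P i -> sch (h i)) -> sch (fun x => \sum_(i <- r | P i) h i x).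
Proof.
move=> sh; elim: r => [|i r IHr].
  have -> : (fun x : R => \sum_(i <- [::] | P i) h i x) = fun=> 0.
    by apply/funext => x; rewrite big_nil.
  exact: sch0.
case Pi : (P i).
  have -> : (fun x => \sum_(j <- i :: r | P j) h j x) =
      fun x => h i x + \sum_(j <- r | P j) h j x.
    by apply/funext => x; rewrite big_cons Pi.
  by apply: schD => //; exact: sh.
have -> : (fun x => \sum_(j <- i :: r | P j) h j x) =
    fun x => \sum_(j <- r | P j) h j x.
  by apply/funext => x; rewrite big_cons Pi.
exact: IHr.
Qed.

Lemma sch_mulx f : sch f -> sch (fun x => x * f x).
Proof.
(* Products [x f] alone are not stable under differentiation, the sums [x f + g] are: the derivative
   is [x f' + (f + g')]. *)
move=> sf; pose P u := exists f' g', [/\ sch f', sch g' & u = fun x => x * f' x + g' x].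
apply: (@sch_coind P); last first.
  exists f, (fun=> 0); split=> //; first exact: sch0.
  by apply/funext => x; rewrite addr0.
move=> _ [{sf}f [g [sf sg ->]]]; split.
  by apply: rapidD; [apply: rapid_mulx|]; exact: sch_rapid.
exists (fun x => x * derive1 f x + (f x + derive1 g x)).
  have := derivD (derivM (@deriv_id R) (sch_deriv sf)) (sch_deriv sg).
  by apply: eq_deriv => x; ring.
exists (derive1 f), (fun x => f x + derive1 g x); split=> //.
  exact: sch_derive1.
by apply: schD => //; exact: sch_derive1.
Qed.

Inductive ode_class g : (R -> R) -> Prop :=
| ode_self : ode_class g g
| ode_sch f : sch f -> ode_class g f
| ode_mulx f : ode_class g f -> ode_class g (fun x => x * f x)
| ode_scale c f : ode_class g f -> ode_class g (fun x => c * f x)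
| ode_add f f' : ode_class g f -> ode_class g f' -> ode_class g (fun x => f x + f' x).

(** The equation puts [g'] back into [ode_class g], which is therefore stable under differentiation;
    decay of [g] itself then controls all its derivatives. It serves for the Gaussian and for the
    solution of [raise g = f]. *)
Lemma sch_ode (c : R) g f : sch f -> rapid g ->
  deriv g (fun x => c * (x * g x) + f x) -> sch g.
Proof.
move=> sf rg dg; apply: (@sch_coind (ode_class g)); last exact: ode_self.
move=> u; elim => {u} [|u su|u Pu [ru [u' du Pu']]|k u _ [ru [u' du Pu']]
    |u v _ [ru [u' du Pu']] _ [rv [v' dv Pv']]].
- split=> //; exists (fun x => c * (x * g x) + f x) => //; apply: ode_add.
    by do 2 constructor; exact: ode_self.
  exact: ode_sch.
- by have [ru [u' du su']] := sch_step su; split=> //; exists u' => //; exact: ode_sch.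
- split; first exact: rapid_mulx.
  exists (fun x => u x + x * u' x).
    by apply: eq_deriv (derivM (@deriv_id R) du) => x; rewrite mul1r.
  by apply: ode_add => //; exact: ode_mulx.
- split; first exact: rapidZ.
  by exists (fun x => k * u' x); [exact: derivZ|exact: ode_scale].
- split; first exact: rapidD.
  by exists (fun x => u' x + v' x); [exact: derivD|exact: ode_add].
Qed.

Definition gaussian (x : R) := expR (- (2^-1 * x ^+ 2)).

Lemma deriv_gaussian : deriv gaussian (fun x => - (x * gaussian x)).
Proof.
have d2 := derivN (derivZ 2^-1 (derivM (@deriv_id R) (@deriv_id R))).
by apply: eq_deriv (deriv_expR d2) => x; rewrite /gaussian expr2; field.
Qed.

Lemma gaussian_gt0 x : 0 < gaussian x. Proof. exact: expR_gt0. Qed.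

Lemma rapid_gaussian : rapid gaussian.
Proof.
have M0 n : exists M : R, forall x, `|x| ^+ (n.+1).*2 * gaussian x <= M.
  (* From [t^(n+1) / (n+1)! <= e^t] at [t = x^2 / 2]. *)
  exists (2 ^+ n.+1 * n.+1`!%:R) => x.
  rewrite /gaussian expRN -mul2n exprM real_normK ?num_real//.
  rewrite ler_pdivrMr ?expR_gt0//.
  have x2 : 0 <= 2^-1 * x ^+ 2 by rewrite mulr_ge0 ?sqr_ge0// invr_ge0.
  have := expR_ge1Dxn n x2; set e := expR _; rewrite exprMn exprVn => eE.
  have : (2 ^+ n.+1)^-1 * x ^+ 2 ^+ n.+1 / n.+1`!%:R <= e.
    by apply: le_trans eE; rewrite lerDr ler01.
  rewrite ler_pdivrMr ?ltr0n ?fact_gt0// mulrC ler_pdivrMr ?exprn_gt0//.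
  by rewrite [e * _]mulrC [_ * 2 ^+ _]mulrC mulrA.
move=> a; have [M aM] := M0 a; exists (1 + M) => x.
rewrite (gtr0_norm (gaussian_gt0 x)).
have g1 : gaussian x <= 1.
  by rewrite /gaussian -expR0 ler_expR oppr_le0 mulr_ge0 ?sqr_ge0// invr_ge0.
apply: le_trans (lerD g1 (aM x)); rewrite -{2}[gaussian x]mul1r -mulrDl.
rewrite ler_wpM2r ?(ltW (gaussian_gt0 x))//.
have [x1|/ltW x1] := leP `|x| 1.
  by apply: (@le_trans _ _ 1); [exact: exprn_ile1|rewrite lerDl exprn_ge0].
rewrite (@le_trans _ _ (`|x| ^+ (a.+1).*2))// ?lerDr ?ler01// ler_weXn2l//.
by rewrite -addnn; exact: leq_trans (leqnSn a) (leq_addr _ _).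
Qed.

Lemma sch_gaussian : sch gaussian.
Proof.
apply: (@sch_ode (-1) gaussian (fun=> 0)); [exact: sch0|exact: rapid_gaussian|].
by apply: eq_deriv deriv_gaussian => x; rewrite mulN1r addr0.
Qed.

Definition lower f x := x * f x + derive1 f x.
Definition raise f x := x * f x - derive1 f x.

Lemma sch_lower f : sch f -> sch (lower f).
Proof. by move=> sf; apply: schD; [exact: sch_mulx|exact: sch_derive1]. Qed.

Lemma sch_raise f : sch f -> sch (raise f).
Proof. by move=> sf; apply: schB; [exact: sch_mulx|exact: sch_derive1]. Qed.

(** The canonical commutation relation; its constant 2 is the spacing of the levels in the spectral
    gap. *)
Lemma lower_raise f : sch f ->
  lower (raise f) = fun x => raise (lower f) x + 2 * f x.
Proof.
move=> sf; have df := sch_deriv sf; have df' := sch_deriv (sch_derive1 sf).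
have dx := derivM (@deriv_id R) df; apply/funext => x.
rewrite /raise /lower (derivE (derivB dx df')) (derivE (derivD dx df')); ring.
Qed.

Section Linearity.
Variables (c : R) (f g : R -> R).
Hypotheses (sf : sch f) (sg : sch g).

Lemma lowerD : lower (fun x => f x + g x) = fun x => lower f x + lower g x.
Proof.
apply/funext => x; rewrite /lower (derivE (derivD (sch_deriv sf) (sch_deriv sg))).
ring.
Qed.

Lemma raiseD : raise (fun x => f x + g x) = fun x => raise f x + raise g x.
Proof.
apply/funext => x; rewrite /raise (derivE (derivD (sch_deriv sf) (sch_deriv sg))).
ring.
Qed.

Lemma lowerZ : lower (fun x => c * f x) = fun x => c * lower f x.
Proof.
by apply/funext => x; rewrite /lower (derivE (derivZ c (sch_deriv sf))); ring.
Qed.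

Lemma raiseZ : raise (fun x => c * f x) = fun x => c * raise f x.
Proof.
by apply/funext => x; rewrite /raise (derivE (derivZ c (sch_deriv sf))); ring.
Qed.

End Linearity.

End SchwartzFunctions.

(** * Gaussian tails and inversion of the raising operator *)

Section InnerProduct.
Variable R : realType.
Implicit Types (f g u F G : R -> R).

(** The right-hand bound on [u] is minus the derivative of [c * gaussian]. So [F - c * gaussian] is
    nondecreasing beyond [x] and tends to 0, hence is at most 0 at [x]; the same holds for [- F]. *)
Lemma gaussian_tail F u (c x : R) : 1 <= x -> deriv F u ->
  (forall y, x <= y -> `|u y| <= c * (y * gaussian y)) ->
  F y @[y --> +oo] --> (0 : R) -> `|F x| <= c * gaussian x.
Proof.
move=> x1 dF uc F0.
have gy : gaussian y @[y --> +oo] --> (0 : R).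
  exact/rapid_cvgy/rapid_gaussian.
have key G v : deriv G v -> (forall y, x <= y -> - v y <= c * (y * gaussian y)) ->
    G y @[y --> +oo] --> (0 : R) -> G x <= c * gaussian x.
  move=> dG vc G0.
  have dH := derivB dG (derivZ c (@deriv_gaussian R)).
  have H0 : (fun y => G y - c * gaussian y) y @[y --> +oo] --> (0 : R).
    suff : (fun y => G y - c * gaussian y) y @[y --> +oo] --> 0 - c * 0.
      by rewrite mulr0 subr0.
    by apply: (cvgB G0); exact: cvgMl_tmp.
  rewrite -subr_le0; apply: (cvgr_to_ge H0).
  near=> y; apply: (deriv_ge0_le dH _ (lexx x)) => [z xz|].
    by have := vc z xz; rewrite mulrN opprK; lra.
  by near: y; apply: nbhs_pinfty_ge; rewrite num_real.
rewrite ler_norml lerNl; apply/andP; split.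
  apply: (key _ _ (derivN dF)) => [y xy|]; last by rewrite -oppr0; exact: cvgN.
  by rewrite opprK; exact: le_trans (ler_norm _) (uc y xy).
by apply: (key _ _ dF) => // y xy; apply: le_trans (ler_norm _) _; rewrite normrN uc.
Unshelve. all: by end_near. Qed.

(* Solving [x g - g' = f] by variation of constants: the solution
   [g = - F / gaussian], with [F' = gaussian * f], decays at both ends exactly
   when the integral of [gaussian * f] vanishes. *)
Lemma raise_surj f : sch f -> integral_is (fun x => f x * gaussian x) 0 ->
  exists2 g, sch g & raise g = f.
Proof.
move=> sf [F [dF F0 Fv]].
pose g x := - (F x * expR (2^-1 * x ^+ 2)).
have gE x : gaussian x * expR (2^-1 * x ^+ 2) = 1 by rewrite -expRD addNr expR0.
have dg : deriv g (fun x => 1 * (x * g x) + -1 * f x).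
  have de := deriv_expR (derivZ 2^-1 (derivM (@deriv_id R) (@deriv_id R))).
  apply: eq_deriv (derivN (derivM dF de)) => x.
  by rewrite /g -expr2 -(mulrA (f x)) gE; field.
have gF x : `|g x| = `|F x| * expR (2^-1 * x ^+ 2).
  by rewrite normrN normrM (gtr0_norm (expR_gt0 _)).
(* For [y >= x >= 1] one has [|h y| <= C / x^a <= C / x^a * y], so [gaussian_tail] applies with
   [c = C / x^a]; multiplying by [e^(x^2/2)] cancels the Gaussian. *)
have tail G h a (C : R) : deriv G (fun x => h x * gaussian x) ->
   (forall x, `|x| ^+ a * `|h x| <= C) -> G x @[x --> +oo] --> (0 : R) ->
   forall y, 1 <= y -> y ^+ a * (`|G y| * expR (2^-1 * y ^+ 2)) <= C.
  move=> dG hC G0 x x1.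
  have x0 : 0 < x by exact: lt_le_trans x1.
  have C0 : 0 <= C by apply: le_trans (hC x); rewrite mulr_ge0 ?exprn_ge0.
  have : `|G x| <= C / x ^+ a * gaussian x.
    apply: gaussian_tail dG _ G0 => // y xy.
    have y0 : 0 < y by exact: lt_le_trans xy.
    have y1 : 1 <= y by exact: le_trans xy.
    rewrite normrM (gtr0_norm (gaussian_gt0 y)) mulrA ler_wpM2r ?(ltW (gaussian_gt0 y))//.
    rewrite mulrAC ler_pdivlMr ?exprn_gt0// mulrC.
    apply: (@le_trans _ _ C); last by rewrite ler_peMr.
    apply: le_trans (hC y); rewrite ler_wpM2r// (gtr0_norm y0).
    by rewrite lerXn2r// nnegrE ltW.
  move=> /(ler_wpM2r (ltW (expR_gt0 (2^-1 * x ^+ 2)))).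
  rewrite -(mulrA _ (gaussian x)) gE mulr1 => /(ler_wpM2l (ltW (exprn_gt0 a x0))).
  by rewrite (mulrCA _ C) divff ?mulr1// gt_eqF// exprn_gt0.
have rg : rapid g.
  move=> a; have [C fC] := sch_rapid sf a.
  have cg : continuous (fun x => `|g x|).
    move=> x; apply: (@continuous_comp _ _ _ g (fun y : R => `|y|)).
      exact: (deriv_continuous dg).
    exact: norm_continuous.
  have [c _ gc] : exists2 c, c \in `[-1, 1]%R &
      forall t, t \in `[-1, 1]%R -> `|g t| <= `|g c|.
    by apply: (@EVT_max R (fun x => `|g x|)) => //; exact: continuous_subspaceT.
  exists (Num.max C `|g c|) => x; rewrite le_max.
  have [x1|/ltW x1] := leP `|x| 1.
    apply/orP; right; apply: le_trans (gc x _); last first.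
      by rewrite in_itv /= -ler_norml.
    by rewrite ler_piMl// exprn_ile1.
  apply/orP; left; move: x1; rewrite ler_normr => /orP[x1|x1].
    by rewrite gF ger0_norm ?(le_trans _ x1)//; exact: tail dF fC Fv _ x1.
  have nx : `|x| = - x.
    by apply: ler0_norm; rewrite -oppr_ge0; exact: le_trans x1.
  (* The left tail is a right tail after reflection. It uses the limit 0 of [F] at [-oo], whereas
     the right tail uses the vanishing of the integral. *)
  have := tail (fun y => F (- y)) (fun y => - f (- y)) a C _ _ _ _ x1.
  rewrite gF nx opprK sqrrN; apply.
  - apply: eq_deriv (deriv_opp dF) => y.
    by rewrite mulNr /gaussian sqrrN.
  - by move=> y; have := fC (- y); rewrite !normrN.
  - exact/(cvgNy_compNP F _).1.
exists g; first by apply: sch_ode rg dg; exact: schZ.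
by apply/funext => x; rewrite /raise (derivE dg); ring.
Qed.

End InnerProduct.

(** * Hermite expansions *)

Section HermiteExpansion.
Variable R : realType.
Implicit Types (f g u : R -> R).

(** The default 0 is taken when no integral exists, which [dotP] excludes for Schwartz functions. *)
Definition dot f g : R := xget 0 [set v | integral_is (fun x => f x * g x) v].

Lemma dotE f g v : integral_is (fun x => f x * g x) v -> dot f g = v.
Proof.
move=> fgv; rewrite /dot; case: xgetP => [w _ fgw|/(_ v)//].
exact: integral_is_uniq fgw fgv.
Qed.

Lemma dotP f g : sch f -> sch g -> integral_is (fun x => f x * g x) (dot f g).
Proof.
move=> sf sg; have [v fgv] : exists v, integral_is (fun x => f x * g x) v.
  apply: integral_exists; last by apply: rapidM; exact: sch_rapid.
  exact: deriv_continuous (derivM (sch_deriv sf) (sch_deriv sg)).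
by rewrite (dotE fgv).
Qed.

Lemma dotC f g : dot f g = dot g f.
Proof.
rewrite /dot; have -> // : (fun x => f x * g x) = (fun x => g x * f x).
by apply/funext => x; rewrite mulrC.
Qed.

Lemma dotDl f g u : sch f -> sch g -> sch u ->
  dot (fun x => f x + g x) u = dot f u + dot g u.
Proof.
move=> sf sg su; apply: dotE; under eq_fun do rewrite mulrDl.
by apply: integral_isD; exact: dotP.
Qed.

Lemma dotZl (c : R) f u : sch f -> sch u -> dot (fun x => c * f x) u = c * dot f u.
Proof.
move=> sf su; apply: dotE; under eq_fun do rewrite -mulrA.
by apply: integral_isZ; exact: dotP.
Qed.

Lemma dot0l u : sch u -> dot (fun=> 0) u = 0.
Proof.
move=> su; rewrite -[RHS](mul0r (dot (fun=> 0) u)) -(dotZl 0 (@sch0 R) su).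
by congr dot; apply/funext => x; rewrite mul0r.
Qed.

Lemma dotBl f g u : sch f -> sch g -> sch u ->
  dot (fun x => f x - g x) u = dot f u - dot g u.
Proof.
move=> sf sg su; have := dotDl sf (schZ (-1) sg) su.
rewrite dotZl// mulN1r => <-; congr dot.
by apply/funext => x; rewrite mulN1r.
Qed.

Lemma dot_sumr (I : Type) (r : seq I) (P : pred I) (h : I -> R -> R) u :
  (forall i, sch (h i)) -> sch u ->
  dot u (fun x => \sum_(i <- r | P i) h i x) = \sum_(i <- r | P i) dot u (h i).
Proof.
move=> sh su; elim: r => [|i r IHr].
  rewrite big_nil -[RHS](dot0l su) dotC; congr dot.
  by apply/funext => x; rewrite big_nil.
rewrite big_cons -IHr; case: ifPn => Pi.
  rewrite !(dotC u) -dotDl//; last by apply: sch_sum.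
  by congr dot; apply/funext => x; rewrite big_cons Pi.
by congr dot; apply/funext => x; rewrite big_cons (negbTE Pi).
Qed.

Lemma dot_ge0 f : sch f -> 0 <= dot f f.
Proof. by move=> sf; apply: integral_is_ge0 (dotP sf sf) => x; exact: sqr_ge0. Qed.

Lemma dot_opp f g : sch f -> sch g ->
  dot (fun x => f (- x)) (fun x => g (- x)) = dot f g.
Proof. by move=> sf sg; apply: dotE; exact: integral_is_opp (dotP sf sg). Qed.

(** Integration by parts: [lower f * g - f * raise g] is the derivative of [f * g]. *)
Lemma dot_lower f g : sch f -> sch g -> dot (lower f) g = dot f (raise g).
Proof.
move=> sf sg; apply/eqP; rewrite -subr_eq0; apply/eqP.
apply: integral_is_uniq.
  have := integral_isZ (-1) (dotP sf (sch_raise sg)).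
  move=> /(integral_isD (dotP (sch_lower sf) sg)); rewrite mulN1r; exact.
have := integral_is_deriv (derivM (sch_deriv sf) (sch_deriv sg)).
rewrite (_ : (fun x => _ + -1 * _) = fun x => derive1 f x * g x + f x * derive1 g x).
  by apply; apply: rapidM; exact: sch_rapid.
by apply/funext => x; rewrite /lower /raise; ring.
Qed.

Lemma dot_raise f g : sch f -> sch g -> dot (raise f) g = dot f (lower g).
Proof. by move=> sf sg; rewrite dotC -dot_lower// dotC. Qed.

Lemma dot_cauchy_schwarz f g : sch f -> sch g ->
  dot f g ^+ 2 <= dot f f * dot g g.
Proof.
move=> sf sg.
have Q (s t : R) : 0 <= s ^+ 2 * dot f f - 2 * s * t * dot f g + t ^+ 2 * dot g g.
  have sh := schB (schZ s sf) (schZ t sg).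
  have := dot_ge0 sh; rewrite dotBl//; try exact: schZ.
  rewrite !(dotC _ (fun x => _ - _)) !dotBl//; try exact: schZ.
  rewrite !dotZl//; try exact: schZ.
  rewrite !(dotC _ (fun x => _ * _)) !dotZl// (dotC g f).
  by move=> q; apply: le_trans q _; rewrite le_eqVlt; apply/orP; left; apply/eqP; ring.
have f0 := dot_ge0 sf; have g0 := dot_ge0 sg.
(* With [a = dot f f] and [b = dot f g]: if [dot g g = 0], the choice [s = b], [t = a + 1] gives
   [- (a + 2) b^2 >= 0], so [b = 0]. Otherwise [s = dot g g], [t = b] is the usual choice. *)
have [g00|gn0] := eqVneq (dot g g) 0.
  move: (Q (dot f g) (dot f f + 1)) (Q 1 (dot f g * (dot f f + 1))).
  rewrite g00 !mulr0 !addr0 => q1 q2.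
  set a := dot f f in f0 q1 q2 *; set b := dot f g in q1 q2 *.
  nra.
have gp : 0 < dot g g by rewrite lt_neqAle eq_sym gn0.
rewrite -(ler_pM2r gp); have := Q (dot g g) (dot f g).
set a := dot f f; set b := dot f g; set c := dot g g; move=> q; nra.
Qed.

(* Unnormalized Hermite functions: no square roots enter the expansions. *)
Fixpoint herm (n : nat) : R -> R := if n is m.+1 then raise (herm m) else @gaussian R.

Lemma sch_herm n : sch (herm n).
Proof. by elim: n => [|n IHn]; [exact: sch_gaussian|exact: sch_raise]. Qed.

(** At [n = 0] the factor [2 * n] vanishes, which makes the truncated index [n.-1] harmless. *)
Lemma lower_herm n : lower (herm n) = fun x => (2 * n)%:R * herm n.-1 x.
Proof.
elim: n => [|n IHn] /=.
  by apply/funext => x; rewrite /lower (derivE (@deriv_gaussian R)) muln0 mul0r; ring.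
rewrite lower_raise; last exact: sch_herm.
rewrite IHn; case: n {IHn} => [|n] /=.
  apply/funext => x; rewrite muln0 muln1 /raise; under eq_fun do rewrite mul0r.
  by rewrite derive1_cst; ring.
rewrite raiseZ; last exact: sch_herm.
by apply/funext => x /=; rewrite !natrM -!natr1; ring.
Qed.

(** Coefficients are divided by this number, and its positivity suffices: the Gaussian integral is
    never evaluated. Were it 0, the monotone antiderivative would vanish identically, and the
    squared Gaussian with it. *)
Lemma dot_herm_gt0 : 0 < dot (herm 0) (herm 0).
Proof.
have [F [dF F0 Fv]] := dotP (sch_herm 0) (sch_herm 0).
have ndF := deriv_nondecreasing dF (fun x => sqr_ge0 (herm 0 x)).
rewrite lt_neqAle eq_sym dot_ge0 ?andbT; last exact: sch_herm.
apply/eqP => v0; rewrite v0 in Fv.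
have F0' x : F x = 0.
  apply/eqP; rewrite eq_le (nondecreasing_cvgy_ge ndF Fv).
  by rewrite (nondecreasing_cvgNy_le ndF F0).
have : F = fun=> 0 by apply/funext.
move=> FE; have := derivE dF; rewrite FE (derivE (@derivC R 0)) => /(congr1 (@^~ 0)).
by move=> /esym/eqP; rewrite /= mulf_eq0 orbb gt_eqF// gaussian_gt0.
Qed.

Lemma dot_herm m n : dot (herm m) (herm n) =
  if m == n then (2 ^ n * n`!)%:R * dot (herm 0) (herm 0) else 0.
Proof.
have S k l : dot (herm k.+1) (herm l) = (2 * l)%:R * dot (herm k) (herm l.-1).
  rewrite /= dot_raise; try exact: sch_herm.
  rewrite lower_herm dotC dotZl; try exact: sch_herm.
  by rewrite dotC.
elim: m n => [|m IHm] [|n].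
- by rewrite eqxx expn0 fact0 mul1r.
- by rewrite dotC S muln0 mul0r.
- by rewrite S muln0 mul0r.
- rewrite S IHm /= eqSS; case: ifP => _; last by rewrite mulr0.
  by rewrite mulrA -natrM factS expnS mulnACA.
Qed.

Definition hcoef f n := dot f (herm n) / ((2 ^ n * n`!)%:R * dot (herm 0) (herm 0)).

Lemma hnorm_neq0 n : (2 ^ n * n`!)%:R * dot (herm 0) (herm 0) != 0.
Proof.
by rewrite mulf_neq0 ?gt_eqF ?dot_herm_gt0// pnatr_eq0 -lt0n muln_gt0 expn_gt0 fact_gt0.
Qed.

Lemma hcoef_raise0 f : sch f -> hcoef (raise f) 0 = 0.
Proof.
move=> sf; rewrite /hcoef dot_raise//; last exact: sch_herm.
rewrite lower_herm muln0 dotC (_ : (fun x => _) = fun=> 0).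
  by rewrite dot0l// mul0r.
by apply/funext => x; rewrite mul0r.
Qed.

Lemma hcoef_raiseS f n : sch f -> hcoef (raise f) n.+1 = hcoef f n.
Proof.
move=> sf; rewrite /hcoef dot_raise//; last exact: sch_herm.
rewrite lower_herm dotC dotZl//; last exact: sch_herm.
rewrite (dotC _ f) factS expnS mulnACA /= [X in _ / (X * _)]natrM.
rewrite -(mulrA (2 * n.+1)%:R (2 ^ n * n`!)%:R) -mulf_div divff ?mul1r//.
Qed.

Lemma hcoef_lower f n : sch f -> hcoef (lower f) n = (2 * n.+1)%:R * hcoef f n.+1.
Proof.
move=> sf; rewrite /hcoef dot_lower//; last exact: sch_herm.
rewrite factS expnS mulnACA (natrM _ (2 * n.+1) (2 ^ n * n`!)).
rewrite -(mulrA (2 * n.+1)%:R (2 ^ n * n`!)%:R).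
have := hnorm_neq0 n; have : (2 * n.+1)%:R != 0 :> R by rewrite pnatr_eq0.
by move=> ? ?; rewrite (invfM (2 * n.+1)%:R) (mulrCA (2 * n.+1)%:R) mulVKf.
Qed.

Definition hpart m f : R -> R := fun x => \sum_(n < m) hcoef f n * herm n x.
Definition hrem m f : R -> R := fun x => f x - hpart m f x.

Lemma sch_hpart m f : sch (hpart m f).
Proof. by apply: sch_sum => n _; apply: schZ; exact: sch_herm. Qed.

Lemma sch_hrem m f : sch f -> sch (hrem m f).
Proof. by move=> sf; apply: schB => //; exact: sch_hpart. Qed.

End HermiteExpansion.

(** * The spectral gap and convergence of Hermite expansions *)

Section Completeness.
Variable R : realType.
Implicit Types (f g : R -> R).
Local Notation herm := (@herm R).

Lemma dot_hpart m f n : dot (hpart m f) (herm n) =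
  if (n < m)%N then dot f (herm n) else 0.
Proof.
rewrite dotC dot_sumr; [|by move=> i; apply: schZ; exact: sch_herm|exact: sch_herm].
transitivity (\sum_(i < m) if i == n :> nat then dot f (herm n) else 0).
  apply: eq_bigr => i _; rewrite dotC dotZl; try exact: sch_herm.
  rewrite dot_herm; case: eqVneq => [->|_]; last by rewrite mulr0.
  by rewrite /hcoef mulfVK// hnorm_neq0.
have [nm|nm] := ltnP n m.
  rewrite (bigD1 (Ordinal nm)) //= eqxx big1 ?addr0// => i /negP ni.
  by case: eqP => // E; case: ni; apply/eqP/val_inj.
by rewrite big1// => i _; case: eqP => // ni; move: (ltn_ord i); rewrite ni ltnNge nm.
Qed.

Lemma dot_hrem m f n : sch f -> (n < m)%N -> dot (hrem m f) (herm n) = 0.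
Proof.
move=> sf nm; rewrite dotBl//; [|exact: sch_hpart|exact: sch_herm].
by rewrite dot_hpart nm subrr.
Qed.

(** Pythagoras: the remainder is orthogonal to the partial sum. *)
Lemma dot_hrem_le m f : sch f -> dot (hrem m f) (hrem m f) <= dot f f.
Proof.
move=> sf; have sr := sch_hrem m sf; have sp := sch_hpart m f.
have pr : dot (hpart m f) (hrem m f) = 0.
  rewrite dotC dot_sumr//; last by move=> i; apply: schZ; exact: sch_herm.
  rewrite big1// => i _; rewrite dotC dotZl//; last exact: sch_herm.
  by rewrite dotC dot_hrem// mulr0.
have fE : f = fun x => hrem m f x + hpart m f x.
  by apply/funext => x; rewrite /hrem subrK.
have -> : dot f f = dot (hrem m f) (hrem m f) + dot (hpart m f) (hpart m f).
  move: (hrem m f) (hpart m f) sr sp pr fE => r p sr sp pr ->.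
  rewrite dotDl//; last exact: schD.
  by rewrite (dotC r) (dotC p) !dotDl// (dotC r p) pr addr0 add0r.
by rewrite lerDl dot_ge0.
Qed.

(* Spectral gap by induction on [m]: writing [f = raise g], the function [g] is
   orthogonal to one Hermite function less, and Cauchy-Schwarz turns the lower
   bound for [g] into one for [f]. *)
Lemma spectral_gap m f : sch f -> (forall n, (n < m)%N -> dot f (herm n) = 0) ->
  (2 * m)%:R * dot f f <= dot (lower f) (lower f).
Proof.
elim: m f => [|m IHm] f sf f0.
  by rewrite muln0 mul0r; exact/dot_ge0/sch_lower.
have [g sg fE] : exists2 g, sch g & raise g = f.
  apply: raise_surj => //; rewrite -(f0 0%N)//.
  by have := dotP sf (@sch_herm R 0).
have sl := sch_lower sg.
have g0 n : (n < m)%N -> dot g (herm n) = 0.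
  move=> nm; have := f0 n.+1 nm; rewrite -fE dot_raise//; last exact: sch_herm.
  rewrite lower_herm dotC dotZl//; last exact: sch_herm.
  by move/eqP; rewrite mulf_eq0 pnatr_eq0 /= dotC => /eqP.
have ff : dot f f = dot (lower f) g.
  by rewrite -{2}fE -dot_lower.
have ffg : dot f f = dot (lower g) (lower g) + 2 * dot g g.
  rewrite ff -{1}fE lower_raise// dotDl//; [|exact: sch_raise|exact: schZ].
  by rewrite dotZl// dot_raise.
have le1 := IHm g sg g0.
have := dot_cauchy_schwarz (sch_lower sf) sg; rewrite -ff.
(* The induction hypothesis gives [2m |g|^2], the commutator the missing [2 |g|^2]. *)
have le2 : (2 * m.+1)%:R * dot g g <= dot f f.
  by rewrite ffg mulnS addnC natrD mulrDl lerD2r.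
have ffge := dot_ge0 sf; have gge := dot_ge0 sg.
move: (dot_ge0 (sch_lower sf)) => lge.
have kge : 0 <= (2 * m.+1)%:R :> R by [].
move: (dot f f) (dot g g) (dot (lower f) (lower f)) (2 * m.+1)%:R le2 ffge gge lge kge.
move=> a c b k ka a0 c0 b0 k0 aa; have [->|an0] := eqVneq a 0; first by rewrite mulr0.
have ap : 0 < a by rewrite lt_neqAle eq_sym an0.
(* Here [|f|^4 <= |A f|^2 |g|^2] and [2(m+1) |g|^2 <= |f|^2]; one factor [|f|^2] is cancelled. *)
rewrite -(ler_pM2r ap); apply: (@le_trans _ _ (b * (k * c))); last by rewrite ler_wpM2l.
by rewrite (mulrCA b) -mulrA ler_wpM2l.
Qed.

Lemma lower_sum (I : Type) (r : seq I) (h : I -> R -> R) :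
  (forall i, sch (h i)) ->
  lower (fun x => \sum_(i <- r) h i x) = fun x => \sum_(i <- r) lower (h i) x.
Proof.
move=> sh; elim: r => [|i r IHr].
  apply/funext => x; rewrite /lower big_nil mulr0 add0r.
  rewrite (_ : (fun x : R => _) = fun=> 0); first by rewrite derive1_cst big_nil.
  by apply/funext => y; rewrite big_nil.
rewrite (_ : (fun x : R => \sum_(j <- i :: r) h j x) =
    fun x => h i x + \sum_(j <- r) h j x); last first.
  by apply/funext => y; rewrite big_cons.
rewrite lowerD//; last exact: sch_sum.
by rewrite IHr; apply/funext => x; rewrite big_cons.
Qed.

Lemma raise_sum (I : Type) (r : seq I) (h : I -> R -> R) :
  (forall i, sch (h i)) ->
  raise (fun x => \sum_(i <- r) h i x) = fun x => \sum_(i <- r) raise (h i) x.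
Proof.
move=> sh; elim: r => [|i r IHr].
  apply/funext => x; rewrite /raise big_nil mulr0 sub0r.
  rewrite (_ : (fun x : R => _) = fun=> 0).
    by rewrite derive1_cst big_nil oppr0.
  by apply/funext => y; rewrite big_nil.
rewrite (_ : (fun x : R => \sum_(j <- i :: r) h j x) =
    fun x => h i x + \sum_(j <- r) h j x); last first.
  by apply/funext => y; rewrite big_cons.
rewrite raiseD//; last exact: sch_sum.
by rewrite IHr; apply/funext => x; rewrite big_cons.
Qed.

Lemma lower_hpart m f : sch f -> lower (hpart m.+1 f) = hpart m (lower f).
Proof.
move=> sf; rewrite lower_sum; last by move=> i; apply: schZ; exact: sch_herm.
apply/funext => x; rewrite big_ord_recl lowerZ; last exact: sch_herm.
rewrite lower_herm muln0 mul0r mulr0 add0r; apply: eq_bigr => i _.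
rewrite lowerZ; last exact: sch_herm.
by rewrite lower_herm hcoef_lower//= mulrA (mulrC (hcoef _ _)).
Qed.

Lemma raise_hpart m f : sch f -> raise (hpart m f) = hpart m.+1 (raise f).
Proof.
move=> sf; rewrite raise_sum; last by move=> i; apply: schZ; exact: sch_herm.
apply/funext => x; rewrite /hpart big_ord_recl hcoef_raise0// mul0r add0r.
apply: eq_bigr => i _; rewrite hcoef_raiseS// raiseZ//; exact: sch_herm.
Qed.

Lemma lower_hrem m f : sch f -> lower (hrem m.+1 f) = hrem m (lower f).
Proof.
move=> sf; have sp := sch_hpart m.+1 f; apply/funext => x.
rewrite /hrem -lower_hpart// /lower.
by rewrite (derivE (derivB (sch_deriv sf) (sch_deriv sp))); ring.
Qed.

Lemma raise_hrem m f : sch f -> raise (hrem m f) = hrem m.+1 (raise f).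
Proof.
move=> sf; have sp := sch_hpart m f; apply/funext => x.
rewrite /hrem -raise_hpart// /raise.
by rewrite (derivE (derivB (sch_deriv sf) (sch_deriv sp))); ring.
Qed.

Definition l2_null (u : nat -> R -> R) :=
  forall e : R, 0 < e -> \forall m \near \oo, dot (u m) (u m) < e.

(** Lowering the remainder gives a remainder of [lower f], whose norm is at most that of [lower f];
    the gap thus bounds the squared norm by a constant over [2 (m + s + 1)]. The successor on [s]
    keeps the cutoff positive, as [lower_hrem] requires. *)
Lemma l2_null_hrem s f : sch f -> l2_null (fun m => hrem (m + s.+1) f).
Proof.
move=> sf e e0; near=> m.
have sr := sch_hrem (m + s.+1) sf.
have := spectral_gap sr (fun n => @dot_hrem _ _ n sf).
rewrite addnS lower_hrem// => /le_trans/(_ (dot_hrem_le _ (sch_lower sf))) le1.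
rewrite -addnS in le1 *.
have dl0 := dot_ge0 (sch_lower sf).
have M0 : 0 < (2 * (m + s.+1))%:R :> R by rewrite ltr0n muln_gt0 addnS.
rewrite -(ltr_pM2l M0); apply: le_lt_trans le1 _.
rewrite -ltr_pdivrMr//; apply: (@lt_le_trans _ _ m%:R).
  by near: m; exact: nbhs_infty_gtr.
by rewrite ler_nat (leq_trans (leq_addr s.+1 m))// leq_pmull.
Unshelve. all: by end_near. Qed.

(** Let [F] be the antiderivative of [g^2 + g'^2] vanishing at [-oo]. Then [F - g^2] has derivative
    [(g - g')^2 >= 0] and limit 0 at [-oo], so [g^2 <= F], and [F] stays below its limit at
    [+oo]. *)
Lemma sobolev_sup g x : sch g ->
  g x ^+ 2 <= dot g g + dot (derive1 g) (derive1 g).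
Proof.
move=> sg; have dg := sch_deriv sg; have sg' := sch_derive1 sg.
have [F [dF F0 Fv]] := integral_isD (dotP sg sg) (dotP sg' sg').
have ndF : {homo F : y z / y <= z}.
  by apply: (deriv_nondecreasing dF) => y; rewrite addr_ge0// -expr2 sqr_ge0.
apply: le_trans (nondecreasing_cvgy_ge ndF Fv x).
have dH := derivB dF (derivM dg dg).
rewrite -subr_ge0 expr2.
have rgg : rapid (fun x => g x * g x) by apply: rapidM; exact: sch_rapid.
apply: (@nondecreasing_cvgNy_le _ (fun x => F x - g x * g x)).
  apply: (deriv_nondecreasing dH) => y.
  by rewrite (_ : _ - _ = (g y - derive1 g y) ^+ 2) ?sqr_ge0//; ring.
suff : F x - g x * g x @[x --> -oo] --> (0 - 0 : R) by rewrite subr0.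
by apply: (cvgB F0); exact: rapid_cvgNy.
Qed.

(* The level counts how many times [lower] can still be applied. *)
Inductive rem_class : nat -> (nat -> R -> R) -> Prop :=
| rem_base l s f : (l <= s)%N -> sch f -> rem_class l (fun m => hrem (m + s) f)
| rem_add l u v : rem_class l u -> rem_class l v ->
    rem_class l (fun m x => u m x + v m x)
| rem_scale l c u : rem_class l u -> rem_class l (fun m x => c * u m x).

Lemma rem_class_sch l u : rem_class l u -> forall m, sch (u m).
Proof.
elim=> {l u} [l s f _ sf|l u v _ su _ sv|l c u _ su] m.
- exact: sch_hrem.
- exact: schD.
- exact: schZ.
Qed.

Lemma rem_class_lower l u : rem_class l.+1 u -> rem_class l (fun m => lower (u m)).
Proof.
move: {-2}l.+1 (erefl l.+1) => k kE ku.
elim: ku l kE => {k u} [k s f ks sf|k u v ku IHu kv IHv|k c u ku IHu] l kE.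
- case: s ks => [|s]; rewrite kE// => ls.
  rewrite (_ : (fun m => _) = fun m => hrem (m + s) (lower f)).
    by apply: rem_base => //; exact: sch_lower.
  by apply/funext => m; rewrite addnS lower_hrem.
- rewrite (_ : (fun m => _) = fun m x => lower (u m) x + lower (v m) x).
    by apply: rem_add; [exact: IHu|exact: IHv].
  by apply/funext => m; rewrite lowerD//; apply: rem_class_sch; eassumption.
- rewrite (_ : (fun m => _) = fun m x => c * lower (u m) x).
    by apply: rem_scale; exact: IHu.
  by apply/funext => m; rewrite lowerZ//; apply: rem_class_sch; eassumption.
Qed.

(** Raising moves the cutoff up. The level is lowered all the same to match [rem_class_lower]:
    multiplication by [x] and differentiation are half the sum and half the difference of the two
    operators and need a common level. *)
Lemma rem_class_raise l u : rem_class l.+1 u -> rem_class l (fun m => raise (u m)).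
Proof.
move: {-2}l.+1 (erefl l.+1) => k kE ku.
elim: ku l kE => {k u} [k s f ks sf|k u v ku IHu kv IHv|k c u ku IHu] l kE.
- rewrite (_ : (fun m => _) = fun m => hrem (m + s.+1) (raise f)).
    apply: rem_base; last exact: sch_raise.
    by rewrite ltnW// ltnW// ltnS -kE.
  by apply/funext => m; rewrite addnS raise_hrem.
- rewrite (_ : (fun m => _) = fun m x => raise (u m) x + raise (v m) x).
    by apply: rem_add; [exact: IHu|exact: IHv].
  by apply/funext => m; rewrite raiseD//; apply: rem_class_sch; eassumption.
- rewrite (_ : (fun m => _) = fun m x => c * raise (u m) x).
    by apply: rem_scale; exact: IHu.
  by apply/funext => m; rewrite raiseZ//; apply: rem_class_sch; eassumption.
Qed.

Lemma rem_class_mulx l u : rem_class l.+1 u -> rem_class l (fun m x => x * u m x).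
Proof.
move=> lu; rewrite (_ : (fun m x => _) =
    fun m x => 2^-1 * (lower (u m) x + raise (u m) x)).
  apply: rem_scale; apply: rem_add; [exact: rem_class_lower|exact: rem_class_raise].
by apply/funext => m; apply/funext => x; rewrite /lower /raise; field.
Qed.

Lemma rem_class_derive l u : rem_class l.+1 u -> rem_class l (fun m => derive1 (u m)).
Proof.
move=> lu; rewrite (_ : (fun m => _) =
    fun m x => 2^-1 * (lower (u m) x + -1 * raise (u m) x)).
  apply: rem_scale; apply: rem_add; first exact: rem_class_lower.
  by apply: rem_scale; exact: rem_class_raise.
by apply/funext => m; apply/funext => x; rewrite /lower /raise; field.
Qed.

Lemma rem_class_l2_null l u : rem_class l.+1 u -> l2_null u.
Proof.
move: {-2}l.+1 (erefl l.+1) => k kE ku.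
elim: ku l kE => {k u} [k s f ks sf|k u v ku IHu kv IHv|k c u ku IHu] l kE.
- by case: s ks => [|s]; rewrite kE// => _; exact: l2_null_hrem.
(* The quarter comes from [|f + g|^2 <= 2 |f|^2 + 2 |g|^2]. *)
- move=> e e0; have e4 : 0 < e / 4 by rewrite divr_gt0.
  near=> m.
  have um : dot (u m) (u m) < e / 4 by near: m; exact: (IHu l).
  have vm : dot (v m) (v m) < e / 4 by near: m; exact: (IHv l).
  have su := rem_class_sch ku m; have sv := rem_class_sch kv m.
  move: um vm su sv; move: (u m) (v m) => f g ff gg sf sg.
  have := dot_ge0 (schB sf sg).
  rewrite dotBl//; last exact: schB.
  rewrite (dotC f (fun x => _ - _)) (dotC g (fun x => _ - _)) !dotBl//.
  rewrite dotDl//; last exact: schD.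
  rewrite (dotC f (fun x => _ + _)) (dotC g (fun x => _ + _)) !dotDl// (dotC g f).
  move: ff gg; set a := dot _ _; set b := dot _ _; set c := dot _ _; lra.
- move=> e e0; have c1 : 0 < c ^+ 2 + 1 by rewrite ltr_wpDl ?sqr_ge0.
  near=> m.
  have um : dot (u m) (u m) < e / (c ^+ 2 + 1).
    by near: m; apply: (IHu l) => //; rewrite divr_gt0.
  have su := rem_class_sch ku m; have u0 := dot_ge0 su.
  rewrite dotZl//; last exact: schZ.
  rewrite dotC dotZl//; move: um; rewrite ltr_pdivlMr//.
  by apply: le_lt_trans; rewrite mulrA mulrC -expr2 ler_wpM2l// lerDl.
Unshelve. all: by end_near. Qed.

Theorem hermite_expansion_cvg f a b (e : R) : sch f -> 0 < e ->
  \forall m \near \oo, forall x, `|x| ^+ a * `|derive1n b (hrem m f) x| <= e.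
Proof.
(* One level for each of the [b] derivatives and [a] multiplications, one for the derivative in
   Sobolev's inequality, and one that [rem_class_l2_null] requires. *)
move=> sf e0; pose l := (a + b).+2.
suff : \forall m \near \oo, forall x,
    `|x| ^+ a * `|derive1n b (hrem (m + l) f) x| <= e.
  move=> [N _ HN]; exists (N + l)%N => // m /= Nm x.
  have -> : m = (m - l + l)%N by rewrite subnK// (leq_trans (leq_addl N l)).
  by apply: HN; rewrite /= leq_subRL ?(leq_trans (leq_addl N l))// addnC.
have lb : forall k, (k <= b)%N ->
    rem_class (l - k) (fun m => derive1n k (hrem (m + l) f)).
  elim=> [|k IHk] kb; first by rewrite subn0; exact: rem_base.
  rewrite (_ : (fun m => _) = fun m => derive1 (derive1n k (hrem (m + l) f))).
    apply: rem_class_derive; rewrite -subSn; first exact/IHk/ltnW.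
    by rewrite (leq_trans kb)// /l !leqW// leq_addl.
  by apply/funext => m; rewrite derive1nS.
have la : forall k, (k <= a)%N -> rem_class (a - k).+2
    (fun m x => x ^+ k * derive1n b (hrem (m + l) f) x).
  elim=> [|k IHk] ka.
    rewrite subn0 (_ : a.+2 = (l - b)%N); last by rewrite /l -2!addSn addnK.
    have h := lb b (leqnn b).
    rewrite (_ : (fun m x => _) = fun m => derive1n b (hrem (m + l) f)) //.
    by apply/funext => m; apply/funext => x; rewrite mul1r.
  rewrite (_ : (fun m x => _) =
      fun m x => x * (x ^+ k * derive1n b (hrem (m + l) f) x)).
    by apply: rem_class_mulx; rewrite -subSn ?subSS//; exact/IHk/ltnW.
  by apply/funext => m; apply/funext => x; rewrite exprS mulrA.
have := la a (leqnn a); rewrite subnn; set h := (X in rem_class _ X) => ra.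
have e2 : 0 < e ^+ 2 / 2 by rewrite divr_gt0 ?exprn_gt0.
near=> m => x.
have n1 : dot (h m) (h m) < e ^+ 2 / 2.
  by near: m; exact: (rem_class_l2_null ra e2).
have n2 : dot (derive1 (h m)) (derive1 (h m)) < e ^+ 2 / 2.
  by near: m; exact: (rem_class_l2_null (rem_class_derive ra) e2).
have hx := sobolev_sup x (rem_class_sch ra m).
rewrite -normrX -normrM -ler_sqr ?nnegrE ?(ltW e0)// real_normK ?num_real//.
by apply: le_trans hx _; rewrite [leRHS]splitr lerD// ltW.
Unshelve. all: by end_near. Qed.

End Completeness.

(** * The chains of Hermite coefficients *)

Section Chains.
Variable R : realType.
Implicit Types (f g : R -> R).
Local Notation herm := (@herm R).

Definition hnorm (n : nat) : R := Num.sqrt (2 ^+ n * n`!%:R * Num.sqrt pi).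

Let hnorm_sqr_gt0 (n : nat) : 0 < 2 ^+ n * n`!%:R * Num.sqrt pi :> R.
Proof. by rewrite !mulr_gt0 ?exprn_gt0 ?ltr0n ?fact_gt0// sqrtr_gt0 pi_gt0. Qed.

Lemma hnorm_gt0 n : 0 < hnorm n. Proof. by rewrite sqrtr_gt0. Qed.

(** As [(gaussian * u)' = - gaussian * raise u], each derivative of [e^(-t^2) = gaussian^2]
    contributes a sign and one [raise]. *)
Lemma derive1n_gauss n : derive1n n (fun t : R => expR (- t ^+ 2)) =
  fun q => (-1) ^+ n * (gaussian q * herm n q).
Proof.
elim: n => [|n IHn].
  apply/funext => q; rewrite derive1n0 expr0 mul1r /= /gaussian -expRD.
  by congr expR; field.
rewrite derive1nS IHn; apply/funext => q.
have dg := derivM (@deriv_gaussian R) (sch_deriv (@sch_herm R n)).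
by rewrite (derivE (derivZ ((-1) ^+ n) dg)) exprS /= /raise; ring.
Qed.

Lemma hermite_funE n q : hermite_fun n q = (hnorm n)^-1 * herm n q.
Proof.
rewrite /hermite_fun derive1n_gauss -/(hnorm n).
have gE : expR (q ^+ 2 / 2) * gaussian q = 1.
  by rewrite /gaussian -expRD mulrC subrr expR0.
have s1 : (-1) ^+ n * (-1) ^+ n = 1 :> R by rewrite -expr2 sqrr_sign.
transitivity ((-1) ^+ n * (-1) ^+ n * (expR (q ^+ 2 / 2) * gaussian q) *
    ((hnorm n)^-1 * herm n q)); first by ring.
by rewrite s1 gE !mul1r.
Qed.

(* The square root of double factorials in front of [psi_n] in the theorem,
   divided by the normalization of [psi_n]. *)
Definition gam (n : nat) : R :=
  Num.sqrt ((dfactn n.-1)%:R / (dfactn n)%:R) / hnorm n.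

Lemma dfactn_gt0 n : (0 < dfactn n)%N.
Proof.
have [k] := ubnP n; elim: k n => // k IHk [|[|n]] //= nk.
by rewrite muln_gt0 /= IHk// -ltnS ltnW.
Qed.

Lemma gam_gt0 n : 0 < gam n.
Proof. by rewrite divr_gt0 ?hnorm_gt0// sqrtr_gt0 divr_gt0// ltr0n dfactn_gt0. Qed.

(** Into index [n + 1], [lower] arrives from [n + 2] with factor [2 (n + 2)] and [raise] from [n]
    with factor 1; the weights [gam] compensate exactly this. The double factorials are compared
    after squaring. *)
Lemma gamSS n : gam n = (2 * n.+2)%:R * gam n.+2.
Proof.
apply/eqP; rewrite -(@eqrXn2 _ 2)//; last 2 first.
- exact/ltW/gam_gt0.
- by rewrite mulr_ge0 ?ler0n ?ltW ?gam_gt0.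
have d0 k : (dfactn k)%:R != 0 :> R by rewrite pnatr_eq0 -lt0n dfactn_gt0.
have dE : (dfactn n.+1)%:R = n.+1%:R * (dfactn n.-1)%:R :> R.
  by case: n => [|n] /=; rewrite ?mul1r// natrM.
rewrite /gam /hnorm !(exprMn, exprVn) !sqr_sqrtr; first last.
- by rewrite divr_ge0.
- exact: ltW.
- by rewrite divr_ge0.
- exact: ltW.
have s0 : Num.sqrt pi != 0 :> R by rewrite sqrtr_eq0 -ltNge pi_gt0.
have f0 : n`!%:R != 0 :> R by rewrite pnatr_eq0 -lt0n fact_gt0.
have e0 : 2 ^+ n != 0 :> R by rewrite expf_neq0// pnatr_eq0.
rewrite [n.+2.-1]/= dE [dfactn n.+2]/= !factS !natrM !exprS.
have n1 : n.+1%:R != 0 :> R by rewrite pnatr_eq0.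
have n2 : n.+2%:R != 0 :> R by rewrite pnatr_eq0.
move: (d0 n) (d0 n.-1).
move: (dfactn n)%:R (dfactn n.-1)%:R (Num.sqrt pi) n`!%:R (2 ^+ n)
  n.+1%:R n.+2%:R s0 f0 e0 n1 n2.
move=> d d' s f e n1 n2 *; apply/eqP; field.
by do ?[apply/andP; split].
Qed.

(* The excluded chains, with [N] odd and [N < 2 h], would start at the Hermite
   function of index 1 of some [f_p] with [0 < p], which [lower] does not kill. *)
Definition chain_index (h N : nat) := ~~ odd N || (2 * h < N)%N.

(** Going from [f_h] down to [f_p] lowers the Hermite index by [2 (h - p)]. The guard makes the
    entry zero where this index would be negative, instead of truncating it to 0. *)
Definition spin_coef (h N p : nat) (q : R) : R :=
  if (2 * (h - p) <= N)%N
  then 'C(h, p)%:R * gam (N - 2 * (h - p)) * herm (N - 2 * (h - p)) q else 0.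

Lemma sch_spin_coef h N p : sch (spin_coef h N p).
Proof.
by rewrite /spin_coef; case: (_ <= _)%N; [apply: schZ; exact: sch_herm|exact: sch0].
Qed.

(** The identity [(p+1) C(h,p+1) = (h-p) C(h,p)] balances the polynomial factors and [gamSS] the
    Hermite factors. *)
Lemma spin_coef_chain h N p q : chain_index h N -> (p < h)%N ->
  p.+1%:R * lower (spin_coef h N p.+1) q = (h - p)%:R * raise (spin_coef h N p) q.
Proof.
move=> hN ph; rewrite /spin_coef.
have [hpN|Nhp] := boolP (2 * (h - p) <= N)%N.
  have -> : (2 * (h - p.+1) <= N)%N by lia.
  rewrite lowerZ; last exact: sch_herm.
  rewrite raiseZ; last exact: sch_herm.
  have -> : (N - 2 * (h - p.+1))%N = (N - 2 * (h - p)).+2 by lia.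
  set n := (N - 2 * (h - p))%N.
  rewrite lower_herm /= (gamSS n) !mulrA -natrM mul_bin_left natrM.
  ring.
have r0 : raise (fun=> 0 : R) = fun=> 0.
  by apply/funext => x; rewrite /raise derive1_cst mulr0 subr0.
rewrite r0 mulr0; case h1: (2 * (h - p.+1) <= N)%N.
  (* The chain starts at [p + 1], with Hermite index 0 or 1. [chain_index] excludes 1, and [lower]
     kills index 0. *)
  have -> : (N - 2 * (h - p.+1) = 0)%N by move: hN; rewrite /chain_index; lia.
  rewrite lowerZ; last exact: sch_herm.
  by rewrite lower_herm muln0 mul0r !mulr0.
by rewrite /lower derive1_cst mulr0 addr0 mulr0.
Qed.

Section ChainSolution.
Variables (h : nat) (f : nat -> R -> R).
Hypothesis sf : forall p, sch (f p).
Hypothesis chain : forall p, (p < h)%N -> forall q,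
  p.+1%:R * lower (f p.+1) q = (h - p)%:R * raise (f p) q.

Let hcoefZ (c : R) g n : sch g -> hcoef (fun x => c * g x) n = c * hcoef g n.
Proof. by move=> sg; rewrite /hcoef dotZl ?mulrA//; exact: sch_herm. Qed.

Let chain_hcoef p n : (p < h)%N ->
  p.+1%:R * hcoef (lower (f p.+1)) n = (h - p)%:R * hcoef (raise (f p)) n.
Proof.
move=> ph; rewrite -!hcoefZ; [|exact: sch_raise|exact: sch_lower].
by congr hcoef; apply/funext => q; exact: chain.
Qed.

(** Read off at [p = h], where every chain has an entry and the binomial is 1. *)
Definition chain_coef (N : nat) := hcoef (f h) N / gam N.

Lemma hcoef_chain N j : (j <= h)%N -> (2 * j <= N)%N ->
  hcoef (f (h - j)) (N - 2 * j) = chain_coef N * 'C(h, h - j)%:R * gam (N - 2 * j).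
Proof.
elim: j => [|j IHj] jh jN.
  by rewrite subn0 muln0 subn0 binn mulr1 divfK// gt_eqF// gam_gt0.
have := IHj (ltnW jh); rewrite (_ : 2 * j <= N)%N; last by lia.
move=> /(_ isT) E.
have jh' : (h - j.+1 < h)%N by lia.
(* At this intermediate index the chain relation links coefficient [N - 2j] of [f_(h-j)] to
   coefficient [N - 2(j+1)] of [f_(h-j-1)]. *)
have := chain_hcoef (N - 2 * j.+1).+1 jh'.
rewrite hcoef_lower; last exact: sf.
rewrite hcoef_raiseS; last exact: sf.
rewrite (_ : (h - j.+1).+1 = h - j)%N; last by lia.
rewrite (_ : (N - 2 * j.+1).+2 = N - 2 * j)%N; last by lia.
rewrite E (_ : N - 2 * j = (N - 2 * j.+1).+2)%N; last by lia.
rewrite (_ : h - (h - j.+1) = j.+1)%N; last by lia.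
have /(congr1 (fun k : nat => k%:R : R)) := mul_bin_left h (h - j.+1).
rewrite (_ : (h - j.+1).+1 = h - j)%N; last by lia.
rewrite (_ : h - (h - j.+1) = j.+1)%N; last by lia.
rewrite !natrM (gamSS (N - 2 * j.+1)).
set m := (N - 2 * j.+1)%N; set a := hcoef _ _; rewrite natrM => bE aE.
have j0 : j.+1%:R != 0 :> R by rewrite pnatr_eq0.
apply: (mulfI j0); rewrite -aE.
transitivity (chain_coef N * (2%:R * m.+2%:R * gam m.+2) *
  ((h - j)%:R * 'C(h, h - j)%:R)).
  ring.
by rewrite bE; ring.
Qed.

(** Followed downwards, such a chain reaches Hermite index 1 in [f_(h-j)] with [j = N./2 < h].
    Lowering brings it to index 0, where the other side of the relation, a raised function, has
    coefficient 0. *)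
Lemma chain_coef_eq0 N : ~~ chain_index h N -> chain_coef N = 0.
Proof.
rewrite negb_or negbK -leqNgt => /andP[oN Nh].
pose j := N./2; have jN : N = (2 * j).+1 by rewrite /j; lia.
have jh : (h - j.+1 < h)%N by lia.
have := chain_hcoef 0 jh; rewrite hcoef_lower; last exact: sf.
rewrite hcoef_raise0; last exact: sf.
rewrite mulr0 (_ : (h - j.+1).+1 = h - j)%N; last by lia.
have := @hcoef_chain N j; rewrite (_ : N - 2 * j = 1)%N; last by lia.
move=> ->; [|lia|lia].
move: (gam_gt0 1); move: (gam 1) (chain_coef N) => g b g0.
move=> /eqP; rewrite !mulf_eq0 !pnatr_eq0 (gt_eqF g0) orbF /=.
rewrite (_ : (h - j == 0)%N = false); last by lia.
rewrite -[('C(h, h - j) == 0)%N]negbK -lt0n bin_gt0 leq_subr orbF => /eqP.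
by [].
Qed.

(** Cutting the chains at [N < M] cuts [f_p] at [M - 2 (h - p)]: the shifted cutoffs keep or drop
    each chain as a whole. *)
Lemma hpart_chain M p q : (p <= h)%N ->
  hpart (M - 2 * (h - p)) (f p) q =
  \sum_(N < M) chain_coef N * spin_coef h N p q.
Proof.
move=> ph; set d := (h - p)%N; rewrite /hpart.
rewrite -(big_mkord xpredT (fun n => hcoef (f p) n * herm n q)).
rewrite -(big_mkord xpredT (fun N => chain_coef N * spin_coef h N p q)).
have z a b : (b <= 2 * d)%N ->
    \sum_(a <= N < b) chain_coef N * spin_coef h N p q = 0.
  move=> bd; rewrite big_nat big1// => N /andP[_ Nb].
  rewrite /spin_coef -/d leqNgt (_ : (N < 2 * d)%N) ?mulr0//; lia.
have [Md|dM] := leqP M (2 * d).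
  by rewrite z// big_geq//; lia.
rewrite (big_cat_nat_idem _ _ (ltnW dM))//= ?addr0// z// add0r.
rewrite -{2}(add0n (2 * d)%N) big_addn; apply: eq_bigr => n _.
rewrite /spin_coef -/d leq_addl addnK.
have := @hcoef_chain (n + 2 * d) d.
rewrite addnK (_ : h - d = p)%N; last by rewrite /d subKn.
by move=> ->; rewrite ?leq_subr ?leq_addl// !mulrA.
Qed.

End ChainSolution.

End Chains.

(** * Complex-valued functions *)

Section ComplexDerivative.
Variable R : realType.
Local Notation C := R[i].
Implicit Types (f g : R -> C).

Definition cder f f' := deriv (fun t => complex.Re (f t)) (fun t => complex.Re (f' t)) /\
  deriv (fun t => complex.Im (f t)) (fun t => complex.Im (f' t)).

Lemma cder_ext f f' g g' : f =1 g -> f' =1 g' -> cder f f' -> cder g g'.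
Proof. by move=> /funext -> /funext ->. Qed.

Lemma cderE f f' : cder f f' -> cderiv f = f'.
Proof.
move=> [fr fi]; apply/funext => t; rewrite /cderiv (derivE fr) (derivE fi).
by case: (f' t).
Qed.

Lemma eq_cder f g g' : g =1 g' -> cder f g -> cder f g'.
Proof. by move=> /funext ->. Qed.

Lemma cderC (c : C) : cder (fun=> c) (fun=> 0).
Proof. by split; exact: derivC. Qed.

Lemma cderD f f' g g' : cder f f' -> cder g g' ->
  cder (fun t => f t + g t) (fun t => f' t + g' t).
Proof.
move=> [fr fi] [gr gi]; split.
  by apply: deriv_ext (derivD fr gr) => t; rewrite raddfD.
by apply: deriv_ext (derivD fi gi) => t; rewrite raddfD.
Qed.

Lemma ReD (a b : C) : @complex.Re R (a + b) = complex.Re a + complex.Re b.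
Proof. exact: raddfD. Qed.

Lemma ImD (a b : C) : @complex.Im R (a + b) = complex.Im a + complex.Im b.
Proof. exact: raddfD. Qed.

Lemma ReM (a b : C) : @complex.Re R (a * b) =
  complex.Re a * complex.Re b - complex.Im a * complex.Im b.
Proof. by case: a b => [a1 a2] [b1 b2]. Qed.

Lemma ImM (a b : C) : @complex.Im R (a * b) =
  complex.Re a * complex.Im b + complex.Im a * complex.Re b.
Proof. by case: a b => [a1 a2] [b1 b2]. Qed.

Lemma cderM f f' g g' : cder f f' -> cder g g' ->
  cder (fun t => f t * g t) (fun t => f' t * g t + f t * g' t).
Proof.
move=> [fr fi] [gr gi]; split.
  apply: deriv_ext (derivB (derivM fr gr) (derivM fi gi)) => t; first by rewrite ReM.
  by rewrite ReD !ReM; ring.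
apply: deriv_ext (derivD (derivM fr gi) (derivM fi gr)) => t /=; first by rewrite ImM.
by rewrite ImD !ImM; ring.
Qed.

Lemma cderZ (c : C) f f' : cder f f' -> cder (fun t => c * f t) (fun t => c * f' t).
Proof.
move=> df; apply: eq_cder (cderM (cderC c) df) => t.
by rewrite mul0r add0r.
Qed.

Lemma cderX n f f' : cder f f' ->
  cder (fun t => f t ^+ n) (fun t => n%:R * f t ^+ n.-1 * f' t).
Proof.
move=> df; elim: n => [|n IHn].
  by apply: eq_cder (cderC 1) => t; rewrite !mul0r.
apply: cder_ext (cderM df IHn) => t /=; first by rewrite exprS.
case: n {IHn} => [|n] /=; first by rewrite expr0; ring.
by rewrite !exprS -(natr1 n.+1); ring.
Qed.

Lemma cder_sum (I : Type) (r : seq I) (f f' : I -> R -> C) :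
  (forall i, cder (f i) (f' i)) ->
  cder (fun t => \sum_(i <- r) f i t) (fun t => \sum_(i <- r) f' i t).
Proof.
move=> df; elim: r => [|i r IHr].
  by apply: cder_ext (cderC 0) => t; rewrite big_nil.
by apply: cder_ext (cderD (df i) IHr) => t; rewrite big_cons.
Qed.

Lemma cderivnE f n : cderivn n f = fun t =>
  derive1n n (fun s => complex.Re (f s)) t +i* derive1n n (fun s => complex.Im (f s)) t.
Proof.
elim: n => [|n IHn]; first by apply/funext => t; rewrite /cderivn /=; case: (f t).
by rewrite /cderivn /= -/(cderivn n f) IHn.
Qed.

Lemma normc_Re (c : C) : `|complex.Re c| <= Normc.normc c.
Proof.
case: c => a b /=; rewrite -sqrtr_sqr ler_sqrt ?lerDl ?sqr_ge0//.
by rewrite addr_ge0 ?sqr_ge0.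
Qed.

Lemma normc_Im (c : C) : `|complex.Im c| <= Normc.normc c.
Proof.
case: c => a b /=; rewrite -sqrtr_sqr ler_sqrt ?lerDr ?sqr_ge0//.
by rewrite addr_ge0 ?sqr_ge0.
Qed.

Lemma normc_le (c : C) : Normc.normc c <= `|complex.Re c| + `|complex.Im c|.
Proof.
case: c => a b /=; rewrite -(@ler_pXn2r _ 2)// ?nnegrE ?sqrtr_ge0 ?addr_ge0//.
rewrite sqr_sqrtr ?addr_ge0 ?sqr_ge0// sqrrD !real_normK ?num_real//.
by rewrite -addrA lerD2l lerDr mulrn_wge0// mulr_ge0.
Qed.

Lemma schwartz_sch f : schwartz f <->
  sch (fun t => complex.Re (f t)) /\ sch (fun t => complex.Im (f t)).
Proof.
split=> [[sf nf]|[sr si]].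
  have bd a b : exists M : R, forall q, `|q| ^+ a * Normc.normc (cderivn b f q) <= M.
    exists (fine (schwartz_norm a b f)) => q.
    have nq : ((`|q| ^+ a * Normc.normc (cderivn b f q))%:E <= schwartz_norm a b f)%E.
      by apply: ereal_sup_ubound; exists q.
    rewrite -lee_fin fineK// ge0_fin_numE//.
    by apply: le_trans nq; rewrite lee_fin mulr_ge0 ?exprn_ge0//
      (le_trans _ (normc_Re _)).
  split=> n; (split; first by move=> x; have [] := sf n x; rewrite cderivnE).
    move=> a; have [M fM] := bd a n; exists M => q; apply: le_trans (fM q).
    rewrite ler_wpM2l ?exprn_ge0//.
    by apply: le_trans (normc_Re _); rewrite cderivnE.
  move=> a; have [M fM] := bd a n; exists M => q; apply: le_trans (fM q).
  rewrite ler_wpM2l ?exprn_ge0//.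
  by apply: le_trans (normc_Im _); rewrite cderivnE.
split=> [n t|a b].
  by rewrite cderivnE /=; split; [case: (sr n)|case: (si n)].
have [_ /(_ a)[M rM]] := sr b; have [_ /(_ a)[N iN]] := si b.
apply: (@le_lt_trans _ _ (M + N)%:E); last exact: ltry.
apply: ge_ereal_sup => _ [q _ <-]; rewrite lee_fin.
apply: le_trans (lerD (rM q) (iN q)); rewrite -mulrDr ler_wpM2l ?exprn_ge0//.
by apply: le_trans (normc_le _) _; rewrite cderivnE.
Qed.

Lemma schwartz_cder f : schwartz f -> cder f (cderiv f).
Proof. by move=> /schwartz_sch[sr si]; split; exact: sch_deriv. Qed.

Lemma schwartzZ (c : C) f : schwartz f -> schwartz (fun t => c * f t).
Proof.
move=> /schwartz_sch[sr si]; apply/schwartz_sch; split.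
  by under eq_fun do rewrite ReM; apply: schB; exact: schZ.
by under eq_fun do rewrite ImM; apply: schD; exact: schZ.
Qed.

Lemma schwartz_sum (I : Type) (r : seq I) (P : pred I) (f : I -> R -> C) :
  (forall i, P i -> schwartz (f i)) -> schwartz (fun t => \sum_(i <- r | P i) f i t).
Proof.
move=> sf; elim: r => [|i r IHr].
  rewrite (_ : (fun t => _) = fun=> 0); first exact: schwartz0.
  by apply/funext => t; rewrite big_nil.
rewrite (_ : (fun t => _) = fun t => (if P i then f i t else 0) +
    \sum_(j <- r | P j) f j t).
  by apply: schwartzD => //; case Pi : (P i); [exact: sf|exact: schwartz0].
by apply/funext => t; rewrite big_cons; case: ifP; rewrite ?add0r.
Qed.

Lemma schwartz_real (f : R -> R) : sch f -> schwartz (fun t => (f t)%:C).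
Proof. by move=> sf; apply/schwartz_sch; split => //; exact: sch0. Qed.

End ComplexDerivative.

(** * Null sequences in the Schwartz space *)

Section NullSequences.
Variable R : realType.
Local Notation C := R[i].

Lemma derive1nD (f g : R -> R) n : sch f -> sch g ->
  derive1n n (fun x => f x + g x) = fun x => derive1n n f x + derive1n n g x.
Proof.
move=> sf sg; elim: n => // n IHn.
have df : deriv (derive1n n f) (derive1n n.+1 f).
  by rewrite derive1nS; apply: deriv_derive1; case: (sf n).
have dg : deriv (derive1n n g) (derive1n n.+1 g).
  by rewrite derive1nS; apply: deriv_derive1; case: (sg n).
by rewrite derive1nS IHn (derivE (derivD df dg)).
Qed.

Lemma derive1nZ (c : R) (f : R -> R) n : sch f ->
  derive1n n (fun x => c * f x) = fun x => c * derive1n n f x.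
Proof.
move=> sf; elim: n => // n IHn.
have df : deriv (derive1n n f) (derive1n n.+1 f).
  by rewrite derive1nS; apply: deriv_derive1; case: (sf n).
by rewrite derive1nS IHn (derivE (derivZ c df)).
Qed.

Definition sch_null (u : nat -> R -> R) := (forall m, sch (u m)) /\
  forall a b (e : R), 0 < e ->
    \forall m \near \oo, forall x, `|x| ^+ a * `|derive1n b (u m) x| <= e.

Lemma sch_nullD u v : sch_null u -> sch_null v -> sch_null (fun m x => u m x + v m x).
Proof.
move=> [su u0] [sv v0]; split=> [m|a b e e0]; first exact: schD.
have e2 : 0 < e / 2 by rewrite divr_gt0.
have := u0 a b _ e2; have := v0 a b _ e2; apply: filterS2 => m vm um x.
rewrite derive1nD//; rewrite [leRHS]splitr; apply: le_trans (lerD (um x) (vm x)).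
by rewrite -mulrDr ler_wpM2l ?exprn_ge0// ler_normD.
Qed.

Lemma sch_nullZ (c : R) u : sch_null u -> sch_null (fun m x => c * u m x).
Proof.
move=> [su u0]; split=> [m|a b e e0]; first exact: schZ.
have c0 : 0 < `|c| + 1 by rewrite ltr_wpDl.
have e2 : 0 < e / (`|c| + 1) by rewrite divr_gt0.
have := u0 a b _ e2; apply: filterS => m um x.
rewrite derive1nZ// normrM mulrCA.
move: (um x); rewrite ler_pdivlMr//; apply: le_trans.
by rewrite mulrC ler_wpM2l ?lerDl// mulr_ge0 ?exprn_ge0.
Qed.

Definition schwartz_null (u : nat -> R -> C) :=
  sch_null (fun m x => complex.Re (u m x)) /\ sch_null (fun m x => complex.Im (u m x)).

Lemma schwartz_nullZ (c : C) u : schwartz_null u -> schwartz_null (fun m x => c * u m x).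
Proof.
move=> [ur ui]; split.
  rewrite (_ : (fun m x => _) = fun m x =>
    complex.Re c * complex.Re (u m x) + - complex.Im c * complex.Im (u m x)).
    by apply: sch_nullD; exact: sch_nullZ.
  by apply/funext => m; apply/funext => x; rewrite ReM mulNr.
rewrite (_ : (fun m x => _) = fun m x =>
  complex.Re c * complex.Im (u m x) + complex.Im c * complex.Re (u m x)).
  by apply: sch_nullD; exact: sch_nullZ.
by apply/funext => m; apply/funext => x; rewrite ImM.
Qed.

Lemma schwartz_nullD u v : schwartz_null u -> schwartz_null v ->
  schwartz_null (fun m x => u m x + v m x).
Proof.
move=> [ur ui] [vr vi]; split.
  rewrite (_ : (fun m x => _) = fun m x => complex.Re (u m x) + complex.Re (v m x)).
    exact: sch_nullD.
  by apply/funext => m; apply/funext => x; rewrite raddfD.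
rewrite (_ : (fun m x => _) = fun m x => complex.Im (u m x) + complex.Im (v m x)).
  exact: sch_nullD.
by apply/funext => m; apply/funext => x; rewrite raddfD.
Qed.

Lemma schwartz_null0 : schwartz_null (fun _ _ => 0).
Proof.
split; (split=> [_|a b e e0]; first exact: sch0); apply: nearW => m x /=.
  have := derive1nZ 0 b (@sch0 R); rewrite (_ : (fun x => 0 * 0) = fun=> 0).
    by move=> ->; rewrite mul0r normr0 mulr0 ltW.
  by apply/funext => y; rewrite mul0r.
have := derive1nZ 0 b (@sch0 R); rewrite (_ : (fun x => 0 * 0) = fun=> 0).
  by move=> ->; rewrite mul0r normr0 mulr0 ltW.
by apply/funext => y; rewrite mul0r.
Qed.

Lemma schwartz_null_sum (I : Type) (r : seq I) (u : I -> nat -> R -> C) :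
  (forall i, schwartz_null (u i)) ->
  schwartz_null (fun m x => \sum_(i <- r) u i m x).
Proof.
move=> u0; elim: r => [|i r IHr].
  rewrite (_ : (fun m x => _) = fun _ _ => 0); first exact: schwartz_null0.
  by apply/funext => m; apply/funext => x; rewrite big_nil.
rewrite (_ : (fun m x => _) = fun m x => u i m x + \sum_(j <- r) u j m x).
  exact: schwartz_nullD.
by apply/funext => m; apply/funext => x; rewrite big_cons.
Qed.

Lemma schwartz_null_norm u a b (e : R) : schwartz_null u -> 0 < e ->
  \forall m \near \oo, (schwartz_norm a b (u m) < e%:E)%E.
Proof.
move=> [[sr r0] [si i0]] e0; have e4 : 0 < e / 4 by rewrite divr_gt0.
have := r0 a b _ e4; have := i0 a b _ e4; apply: filterS2 => m im rm.
apply: (@le_lt_trans _ _ (e / 2)%:E); last first.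
  by rewrite lte_fin ltr_pdivrMr// mulrDr mulr1 ltrDl.
apply: ge_ereal_sup => _ [q _ <-]; rewrite lee_fin.
have -> : e / 2 = e / 4 + e / 4 by field.
apply: le_trans (lerD (rm q) (im q)); rewrite -mulrDr ler_wpM2l ?exprn_ge0//.
by apply: le_trans (normc_le _) _; rewrite cderivnE.
Qed.

End NullSequences.

(** * Polynomial spinors in z and zbar *)

Section HomogeneousForms.
Variable K : comNzRingType.

Definition homogeneous k (F : K -> K -> K) := exists e : nat -> K,
  forall X Y, F X Y = \sum_(i < k.+1) e i * (X ^+ i * Y ^+ (k - i)).

Lemma homogeneous_mul k (a b : K) F : homogeneous k F ->
  homogeneous k.+1 (fun X Y => (a * X + b * Y) * F X Y).
Proof.
move=> [e FE]; exists (fun i => (if i is j.+1 then a * e j else 0) +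
  (if (i <= k)%N then b * e i else 0)) => X Y.
under [RHS]eq_bigr do rewrite mulrDl; rewrite big_split /= mulrDl FE.
congr (_ + _).
  rewrite [RHS]big_ord_recl mul0r add0r big_distrr /=; apply: eq_bigr => i _.
  by rewrite /bump /= add1n subSS exprS; ring.
rewrite [RHS]big_ord_recr /= ltnn mul0r addr0 big_distrr /=; apply: eq_bigr => i _.
have ik : (i <= k)%N by rewrite -ltnS.
by rewrite ik subSn// exprS; ring.
Qed.

(** Both changes of basis are instances: powers of [z] and [zbar] are linear forms in [x, y], and
    conversely. *)
Lemma homogeneous_prod_linear (a b c d : K) m n : homogeneous (m + n)
  (fun X Y => (a * X + b * Y) ^+ m * (c * X + d * Y) ^+ n).
Proof.
elim: m => [|m IHm].
  elim: n => [|n [e eE]].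
    by exists (fun=> 1) => X Y; rewrite big_ord1 !expr0 !mulr1.
  have [e' e'E] := homogeneous_mul c d (ex_intro _ e eE).
  by exists e' => X Y; rewrite -e'E /= !expr0 !mul1r exprS.
have [e' e'E] := homogeneous_mul a b IHm.
by exists e' => X Y; rewrite addSn -e'E /= exprS mulrA.
Qed.

End HomogeneousForms.

Lemma poly_eq0_inf (K : idomainType) (n : nat) (a r : nat -> K) : injective r ->
  (forall k, \sum_(i < n) a i * r k ^+ i = 0) -> forall i, (i < n)%N -> a i = 0.
Proof.
move=> rI ar i ni; pose P := \poly_(i < n) a i.
suff P0 : P = 0 by have := coef_poly n a i; rewrite -/P P0 coef0 ni => <-.
apply/eqP; case: eqP => // /eqP P0.
have := @max_poly_roots _ P (map r (iota 0 n)) P0.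
rewrite map_inj_uniq// iota_uniq size_map size_iota ltnNge size_poly => /(_ _ isT) h.
suff : false by [].
apply: h; apply/allP => _ /mapP[k _ ->]; apply/eqP.
by rewrite horner_poly ar.
Qed.

Section ZForms.
Variable R : realType.
Local Notation C := R[i].
Implicit Types (x y q : R).

Lemma spinor_sumE (I : Type) (r : seq I) (F : I -> spinor R) x y q :
  (\sum_(i <- r) F i) x y q = \sum_(i <- r) F i x y q.
Proof.
elim: r => [|i r IHr]; first by rewrite !big_nil.
by rewrite !big_cons -IHr.
Qed.

Lemma zE x y : x +i* y = x%:C + 'i * y%:C.
Proof. by simpc. Qed.

Lemma zbarE x y : x -i* y = x%:C + - 'i * y%:C.
Proof. by simpc. Qed.

Lemma natCE n : n%:R = (n%:R)%:C :> C.
Proof. by rewrite rmorph_nat. Qed.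

Definition zform h (f : nat -> R -> C) : spinor R :=
  fun x y q => \sum_(p < h.+1) f p q * zpol h p x y.

Definition zsum H (f : nat -> nat -> R -> C) : spinor R :=
  fun x y q => \sum_(h < H) zform h (f h) x y q.

Lemma zpol_monomials : exists m : nat -> nat -> nat -> C, forall h p, (p <= h)%N ->
  forall x y, zpol h p x y = \sum_(i < h.+1) m h p i * (x ^+ i * y ^+ (h - i))%:C.
Proof.
have P h p : exists e : nat -> C, (p <= h)%N -> forall x y,
    zpol h p x y = \sum_(i < h.+1) e i * (x ^+ i * y ^+ (h - i))%:C.
  have [e eE] := @homogeneous_prod_linear C 1 (- 'i) 1 'i (h - p) p.
  exists e => ph x y; have := eE x%:C y%:C; rewrite subnK// !mul1r -zE -zbarE => zpE.
  by rewrite /zpol zpE; apply: eq_bigr => i _; rewrite rmorphM !rmorphXn.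
by exists (fun h => projT1 (choice (P h))) => h; exact: projT2 (choice (P h)).
Qed.

Lemma monomial_zpols : exists w : nat -> nat -> nat -> C, forall h i, (i <= h)%N ->
  forall x y, (x ^+ i * y ^+ (h - i))%:C = \sum_(p < h.+1) w h i p * zpol h p x y.
Proof.
have P h i : exists e : nat -> C, (i <= h)%N -> forall x y,
    (x ^+ i * y ^+ (h - i))%:C = \sum_(p < h.+1) e p * zpol h p x y.
  have [e eE] := @homogeneous_prod_linear C 2^-1 2^-1 (- 'i / 2) ('i / 2) i (h - i).
  exists e => ih x y; have := eE (x +i* y) (x -i* y); rewrite subnKC//.
  have i2 : 'i * 'i = -1 :> C by simpc.
  have -> : 2^-1 * (x +i* y) + 2^-1 * (x -i* y) = x%:C.
    by rewrite zE zbarE; field.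
  have -> : - 'i / 2 * (x +i* y) + 'i / 2 * (x -i* y) = y%:C.
    rewrite zE zbarE.
    by transitivity (- ('i * 'i) * y%:C); [field|rewrite i2 opprK mul1r].
  rewrite rmorphM !rmorphXn => ->; apply: eq_bigr => p _.
  by rewrite /zpol (mulrC (_ ^+ p)).
by exists (fun h => projT1 (choice (P h))) => h; exact: projT2 (choice (P h)).
Qed.

Lemma zpol_scale h p (t x y : R) : (p <= h)%N ->
  zpol h p (t * x) (t * y) = t%:C ^+ h * zpol h p x y.
Proof.
move=> ph; rewrite /zpol.
have -> : t * x -i* (t * y) = t%:C * (x -i* y) by simpc.
have -> : t * x +i* (t * y) = t%:C * (x +i* y) by simpc.
by rewrite !exprMn mulrACA -exprD subnK.
Qed.

(* Scaling separates the degrees; for one degree, put [(x, y) = (1, t)] and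
   divide by a power of [zbar] to get a polynomial in [z / zbar]. *)
Lemma zpol_free H (a : nat -> nat -> C) :
  (forall x y, \sum_(h < H) \sum_(p < h.+1) a h p * zpol h p x y = 0) ->
  forall h p, (h < H)%N -> (p <= h)%N -> a h p = 0.
Proof.
move=> a0 h p hH ph.
have ah x y : \sum_(p < h.+1) a h p * zpol h p x y = 0.
  pose S h' := \sum_(p < h'.+1) a h' p * zpol h' p x y.
  apply: (@poly_eq0_inf C H S (fun k => k%:R)) hH => [k l /eqP|k].
    by rewrite eqr_nat => /eqP.
  rewrite -[RHS](a0 (k%:R * x) (k%:R * y)); apply: eq_bigr => h' _.
  rewrite /S big_distrl /=; apply: eq_bigr => p' _.
  have ph' : (p' <= h')%N by rewrite -ltnS.
  by rewrite (zpol_scale _ _ _ ph') -(natCE k) -mulrA (mulrC (zpol h' p' x y)).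
pose w (k : nat) : C := (1 +i* k%:R) / (1 -i* k%:R).
have zb0 (k : nat) : 1 -i* k%:R != 0 :> C by rewrite eq_complex /= oner_eq0.
apply: (@poly_eq0_inf C h.+1 (a h) w) ph => [k l|k].
  move=> /eqP; rewrite /w eqr_div ?zb0//.
  rewrite eq_complex /= => /andP[_]; rewrite !mul1r !mulr1 => /eqP kl.
  have : k%:R = l%:R :> R by lra.
  by move=> /eqP; rewrite eqr_nat => /eqP.
apply: (mulIf (expf_neq0 h (zb0 k))); rewrite mul0r -[RHS](ah 1 k%:R) big_distrl /=.
apply: eq_bigr => p' _; have ph' : (p' <= h)%N by rewrite -ltnS.
have -> : (1 -i* k%:R) ^+ h = (1 -i* k%:R) ^+ (h - p') * (1 -i* k%:R) ^+ p' :> C.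
  by rewrite -exprD subnK.
rewrite /zpol /w exprMn exprVn -mulrA; congr (_ * _).
by rewrite mulrCA divfK ?expf_neq0.
Qed.

Lemma zsum_free H (f : nat -> nat -> R -> C) : zsum H f = 0 ->
  forall h p q, (h < H)%N -> (p <= h)%N -> f h p q = 0.
Proof.
move=> f0 h p q hH ph; apply: (@zpol_free H (fun h p => f h p q)) hH ph => x y.
exact: (congr1 (fun u : spinor R => u x y q) f0).
Qed.

End ZForms.

(** Passes from summation by total degree, as in [zsum], to summation over a square of exponents, as
    in [pol_spinor]. *)
Lemma triangular_sum (V : nmodType) (H : nat) (F : nat -> nat -> V) :
  \sum_(h < H) \sum_(i < h.+1) F i (h - i)%N =
  \sum_(i < H) \sum_(j < H) (if (i + j < H)%N then F i j else 0).
Proof.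
transitivity (\sum_(h < H) \sum_(i < H) if (i <= h)%N then F i (h - i)%N else 0).
  apply: eq_bigr => h _; rewrite (big_ord_widen H (fun i => F i (h - i)%N))//.
  by rewrite big_mkcond.
rewrite exchange_big /=; apply: eq_bigr => i _; have iH := ltnW (ltn_ord i).
rewrite -(big_mkord xpredT (fun h => if (i <= h)%N then F i (h - i)%N else 0)).
rewrite (big_cat_nat_idem _ _ iH)//= ?addr0//; rewrite big_nat big1 ?add0r; last first.
  by move=> h /andP[_ hi]; rewrite leqNgt hi.
rewrite -{1}(add0n (i : nat)) big_addn.
rewrite -(big_mkord xpredT (fun j => if (i + j < H)%N then F i j else 0)).
rewrite [RHS](big_cat_nat_idem _ (leq0n (H - i)) (leq_subr _ _))//= ?addr0//.
rewrite [X in _ + X]big_nat [X in _ + X]big1 ?addr0; last first.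
  by move=> j /andP[ij _]; rewrite ltnNge -leq_subLR ij.
rewrite big_nat [RHS]big_nat; apply: eq_bigr => j /andP[_ jH].
by rewrite leq_addl addnK -ltn_subRL jH.
Qed.

(** * The Dirac operator in z and zbar *)

Section Dirac.
Variable R : realType.
Local Notation C := R[i].
Implicit Types (x y q : R).

Lemma Polh_S_zform h (u : spinor R) : Polh_S h u <->
  exists f, (forall p, schwartz (f p)) /\ u = zform h f.
Proof.
have [w wE] := monomial_zpols R; have [m mE] := zpol_monomials R.
split=> [[c [sc ->]]|[f [sf ->]]].
  exists (fun p q => \sum_(i < h.+1) w h i p * c i q); split.
    by move=> p; apply: schwartz_sum => i _; exact: schwartzZ.
  apply/funext => x; apply/funext => y; apply/funext => q.
  under eq_bigr => i _ do rewrite (wE h i (ltn_ord i)) big_distrl /=.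
  rewrite exchange_big /=; apply: eq_bigr => p _; rewrite big_distrl /=.
  by apply: eq_bigr => i _; ring.
exists (fun i q => \sum_(p < h.+1) m h p i * f p q); split.
  by move=> p; apply: schwartz_sum => i _; exact: schwartzZ.
apply/funext => x; apply/funext => y; apply/funext => q.
rewrite /zform; under eq_bigr => p _ do rewrite (mE h p (ltn_ord p)) big_distrr /=.
rewrite exchange_big /=; apply: eq_bigr => p _; rewrite big_distrr /=.
by apply: eq_bigr => i _; ring.
Qed.

Lemma zsum_pol_spinor : exists m : nat -> nat -> nat -> C, forall H f,
  zsum H f = pol_spinor H (fun i j => if (i + j < H)%N
    then fun q => \sum_(p < (i + j).+1) m (i + j)%N p i * f (i + j)%N p q
    else fun=> 0).
Proof.
have [m mE] := zpol_monomials R; exists m => H f.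
apply/funext => x; apply/funext => y; apply/funext => q.
pose F i j := \sum_(p < (i + j).+1)
  (x ^+ i * y ^+ j)%:C * (m (i + j)%N p i * f (i + j)%N p q).
transitivity (\sum_(h < H) \sum_(i < h.+1) F i (h - i)%N).
  apply: eq_bigr => h _; rewrite /zform /F.
  under eq_bigr => p _ do rewrite (mE h p (ltn_ord p)) big_distrr /=.
  rewrite exchange_big /=; apply: eq_bigr => i _.
  have ih : (i <= h)%N by rewrite -ltnS.
  by rewrite subnKC//; apply: eq_bigr => p _; ring.
rewrite triangular_sum; apply: eq_bigr => i _; apply: eq_bigr => j _.
by case: ifP => _; rewrite ?mulr0// big_distrr.
Qed.

Lemma zsum_Pol_S H f : (forall h p, schwartz (f h p)) -> Pol_S (zsum H f : spinor R).
Proof.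
move=> sf; have [m ->] := zsum_pol_spinor; exists H; eexists; split; last by [].
move=> i j /=; case: (i + j < H)%N; last exact: schwartz0.
by apply: schwartz_sum => p _; exact: schwartzZ.
Qed.

Lemma Pol_S_zsum (u : spinor R) : Pol_S u ->
  exists H f, (forall h p, schwartz (f h p)) /\ u = zsum H f.
Proof.
have [w wE] := monomial_zpols R.
move=> [n [c [sc ->]]].
pose d i j : R -> C := if (i < n)%N && (j < n)%N then c i j else fun=> 0.
(* Total degrees on the square [i, j < n] stay below [n + n], so after padding only zero entries lie
   outside the triangle. *)
have -> : pol_spinor n c = pol_spinor (n + n) d := pol_spinor_pad c (leq_addr n n).
have sd i j : schwartz (d i j) by rewrite /d; case: ifP => // _; exact: schwartz0.
exists (n + n)%N, (fun h p q => \sum_(i < h.+1) w h i p * d i (h - i)%N q); split.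
  by move=> h p; apply: schwartz_sum => i _; exact: schwartzZ.
apply/funext => x; apply/funext => y; apply/funext => q.
transitivity (\sum_(h < n + n) \sum_(i < h.+1)
    (x ^+ i * y ^+ (h - i))%:C * d i (h - i)%N q).
  rewrite (triangular_sum _ (fun i j => (x ^+ i * y ^+ j)%:C * d i j q)).
  apply: eq_bigr => i _; apply: eq_bigr => j _; case: ifPn => // ij.
  by rewrite /d (_ : _ && _ = false) ?mulr0//; lia.
apply: eq_bigr => h _; rewrite /zform.
under eq_bigr => i _ do rewrite (wE h i (ltn_ord i)) big_distrl /=.
rewrite exchange_big /=; apply: eq_bigr => p _; rewrite big_distrl /=.
by apply: eq_bigr => i _; ring.
Qed.

Definition craise (f : R -> C) q := q%:C * f q - cderiv f q.
Definition clower (f : R -> C) q := q%:C * f q + cderiv f q.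

Let cder_z y : cder (fun t => t +i* y) (fun=> 1).
Proof. by split; [exact: deriv_id|exact: derivC]. Qed.

Let cder_zbar y : cder (fun t => t -i* y) (fun=> 1).
Proof. by split; [exact: deriv_id|exact: derivC]. Qed.

Let cder_zy x : cder (fun t => x +i* t) (fun=> 'i).
Proof. by split; [exact: derivC|exact: deriv_id]. Qed.

Let cder_zbary x : cder (fun t => x -i* t) (fun=> - 'i).
Proof.
split; first by apply: eq_deriv (derivC x) => t /=; rewrite oppr0.
by apply: eq_deriv (derivN (@deriv_id R)) => t.
Qed.

Definition zpol_dz h p x y : C := p%:R * ((x -i* y) ^+ (h - p) * (x +i* y) ^+ p.-1).
Definition zpol_dzbar h p x y : C :=
  (h - p)%:R * ((x -i* y) ^+ (h - p).-1 * (x +i* y) ^+ p).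

Let cder_zpolx h p y :
  cder (fun t => zpol h p t y) (fun t => zpol_dz h p t y + zpol_dzbar h p t y).
Proof.
apply: eq_cder (cderM (cderX (h - p) (cder_zbar y)) (cderX p (cder_z y))) => t.
by rewrite /zpol_dz /zpol_dzbar; ring.
Qed.

Let cder_zpoly h p x :
  cder (fun t => zpol h p x t) (fun t => 'i * (zpol_dz h p x t - zpol_dzbar h p x t)).
Proof.
apply: eq_cder (cderM (cderX (h - p) (cder_zbary x)) (cderX p (cder_zy x))) => t.
by rewrite /zpol_dz /zpol_dzbar; ring.
Qed.

(** Entry [p] of degree [h + 1] under the [zbar] derivative and entry [p + 1] under the [z]
    derivative meet at [zbar^(h-p) z^p]; [H.-1] records the drop in degree. *)
Lemma Dirac_zsum H f : (forall h p, schwartz (f h p)) ->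
  Dirac (zsum H f) = zsum H.-1 (fun h p q =>
    (h.+1 - p)%:R * craise (f h.+1 p) q - p.+1%:R * clower (f h.+1 p.+1) q).
Proof.
move=> sf; apply/funext => x; apply/funext => y; apply/funext => q; rewrite /Dirac.
have -> : dq (zsum H f) = zsum H (fun h p => cderiv (f h p)).
  apply/funext => x'; apply/funext => y'; rewrite /dq; apply: cderE.
  apply: cder_sum => h; apply: cder_sum => p.
  apply: eq_cder (cderM (schwartz_cder (sf h p)) (cderC (zpol h p x' y'))) => t.
  by rewrite mulr0 addr0.
have -> : dx (zsum H (fun h p => cderiv (f h p))) x y q =
    \sum_(h < H) \sum_(p < h.+1) cderiv (f h p) q *
      (zpol_dz h p x y + zpol_dzbar h p x y).
  have E : cder (fun t => zsum H (fun h p => cderiv (f h p)) t y q)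
      (fun t => \sum_(h < H) \sum_(p < h.+1) cderiv (f h p) q *
        (zpol_dz h p t y + zpol_dzbar h p t y)).
    by apply: cder_sum => h; apply: cder_sum => p; apply: cderZ; exact: cder_zpolx.
  by rewrite /dx (cderE E).
have -> : dy (zsum H f) x y q =
    \sum_(h < H) \sum_(p < h.+1) f h p q *
      ('i * (zpol_dz h p x y - zpol_dzbar h p x y)).
  have E : cder (fun t => zsum H f x t q)
      (fun t => \sum_(h < H) \sum_(p < h.+1) f h p q *
        ('i * (zpol_dz h p x t - zpol_dzbar h p x t))).
    by apply: cder_sum => h; apply: cder_sum => p; apply: cderZ; exact: cder_zpoly.
  by rewrite /dy (cderE E).
rewrite big_distrr /= -sumrB.
have term h : 'i * q%:C * (\sum_(p < h.+1) f h p q *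
      ('i * (zpol_dz h p x y - zpol_dzbar h p x y))) -
    \sum_(p < h.+1) cderiv (f h p) q * (zpol_dz h p x y + zpol_dzbar h p x y) =
    \sum_(p < h.+1) (craise (f h p) q * zpol_dzbar h p x y -
       clower (f h p) q * zpol_dz h p x y).
  rewrite big_distrr /= -sumrB; apply: eq_bigr => p _; rewrite /craise /clower.
  have i2 : 'i * 'i = -1 :> C by simpc.
  transitivity (- ('i * 'i) * q%:C * f h p q * (zpol_dzbar h p x y - zpol_dz h p x y)
    - cderiv (f h p) q * (zpol_dz h p x y + zpol_dzbar h p x y)); first by ring.
  by rewrite i2; ring.
under eq_bigr => h _ do rewrite term.
case: H => [|H]; first by rewrite /zsum !big_ord0.
rewrite big_ord_recl big_ord1 /zpol_dz /zpol_dzbar !mul0r !mulr0 subrr add0r.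
apply: eq_bigr => h _; rewrite sumrB big_ord_recr /= /bump /= add1n.
rewrite subnn mul0r mulr0 addr0.
rewrite [X in _ - X]big_ord_recl mul0r mulr0 add0r -sumrB; apply: eq_bigr => p _.
have ph : (p <= h)%N by rewrite -ltnS.
by rewrite /= (_ : bump 0 p = p.+1)// subSS subSn//= /zpol; ring.
Qed.

End Dirac.

(** * Solutions and their approximation by chains *)

Section Solutions.
Variable R : realType.
Local Notation C := R[i].
Implicit Types (x y q : R).

Lemma Re_craise (f : R -> C) q :
  complex.Re (craise f q) = raise (fun t => complex.Re (f t)) q.
Proof. by rewrite /craise /raise /cderiv; case: (f q) => a b /=; ring. Qed.

Lemma Im_craise (f : R -> C) q :
  complex.Im (craise f q) = raise (fun t => complex.Im (f t)) q.
Proof. by rewrite /craise /raise /cderiv; case: (f q) => a b /=; ring. Qed.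

Lemma Re_clower (f : R -> C) q :
  complex.Re (clower f q) = lower (fun t => complex.Re (f t)) q.
Proof. by rewrite /clower /lower /cderiv; case: (f q) => a b /=; ring. Qed.

Lemma Im_clower (f : R -> C) q :
  complex.Im (clower f q) = lower (fun t => complex.Im (f t)) q.
Proof. by rewrite /clower /lower /cderiv; case: (f q) => a b /=; ring. Qed.

Lemma eqC_ReIm (a b : C) :
  complex.Re a = complex.Re b -> complex.Im a = complex.Im b -> a = b.
Proof. by case: a b => [a1 a2] [b1 b2] /= -> ->. Qed.

Lemma Re_natM n (a : C) : complex.Re (n%:R * a) = n%:R * complex.Re a.
Proof. by rewrite natCE; case: a => a b /=; ring. Qed.

Lemma Im_natM n (a : C) : complex.Im (n%:R * a) = n%:R * complex.Im a.
Proof. by rewrite natCE; case: a => a b /=; ring. Qed.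

Lemma eq_zsum H (f g : nat -> nat -> R -> C) :
  (forall h p q, (h < H)%N -> (p <= h)%N -> f h p q = g h p q) -> zsum H f = zsum H g.
Proof.
move=> fg; apply/funext => x; apply/funext => y; apply/funext => q.
by apply: eq_bigr => h _; apply: eq_bigr => p _; rewrite fg// -ltnS.
Qed.

Lemma zsum0 H : zsum H (fun _ _ _ => 0 : C) = 0.
Proof.
apply/funext => x; apply/funext => y; apply/funext => q.
by rewrite /zsum big1// => h _; rewrite /zform big1// => p _; rewrite mul0r.
Qed.

(** Embeds one degree into [zsum], so that the homogeneous spaces and the whole kernel share the
    same lemmas. *)
Definition single h (f : nat -> R -> C) (h' p : nat) : R -> C :=
  if h' == h then f p else fun=> 0.

Lemma zform_zsum h f : zform h f = zsum h.+1 (single h f).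
Proof.
apply/funext => x; apply/funext => y; apply/funext => q.
rewrite /zsum big_ord_recr /= big1 ?add0r => [|h' _].
  by rewrite /single eqxx.
by rewrite /zform big1// => p _; rewrite /single ltn_eqF// mul0r.
Qed.

Lemma schwartz_single h f : (forall p, schwartz (f p)) ->
  forall h' p, schwartz (single h f h' p).
Proof. by move=> sf h' p; rewrite /single; case: eqP => // _; exact: schwartz0. Qed.

Lemma Dirac_zsum_eq0 H f : (forall h p, schwartz (f h p)) ->
  Dirac (zsum H f) = 0 <-> forall h p q, (h < H)%N -> (p < h)%N ->
    p.+1%:R * clower (f h p.+1) q = (h - p)%:R * craise (f h p) q.
Proof.
move=> sf; rewrite Dirac_zsum//; split=> [/zsum_free f0 [|h] p q // hH ph|f0].
  apply/esym/eqP; rewrite -subr_eq0; apply/eqP; apply: f0 => //; lia.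
rewrite -[RHS](zsum0 H.-1); apply: eq_zsum => h p q hH ph.
by rewrite f0 ?subrr//; lia.
Qed.

Definition spin h N : spinor R := zform h (fun p q => (spin_coef h N p q)%:C).

Lemma spin_monogenic h N : chain_index h N -> monogenic h (spin h N).
Proof.
move=> hN; have ss p : schwartz (fun q => (spin_coef h N p q)%:C).
  by apply: schwartz_real; exact: sch_spin_coef.
have ss' := schwartz_single h ss.
split; first by apply/Polh_S_zform; eexists; split; last by [].
rewrite /spin zform_zsum; split; first exact: zsum_Pol_S.
apply/Dirac_zsum_eq0 => // h' p q _ ph; rewrite /single.
case: eqP => [E|_]; last first.
  rewrite /clower /craise !(cderE (cderC 0)) mulr0 subrr addr0 !mulr0//.
subst h'; apply: eqC_ReIm.
  by rewrite !Re_natM Re_craise Re_clower spin_coef_chain.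
rewrite !Im_natM Im_craise Im_clower /= /raise /lower derive1_cst.
by rewrite !mulr0 subr0 addr0 !mulr0.
Qed.

Section Approximation.
Variables (h : nat) (f : nat -> R -> C).
Hypothesis sf : forall p, schwartz (f p).
Hypothesis chain : forall p q, (p < h)%N ->
  p.+1%:R * clower (f p.+1) q = (h - p)%:R * craise (f p) q.

Definition spin_coord N : C :=
  chain_coef h (fun p q => complex.Re (f p q)) N +i*
  chain_coef h (fun p q => complex.Im (f p q)) N.

Let sfr p : sch (fun q => complex.Re (f p q)).
Proof. by have /schwartz_sch[] := sf p. Qed.

Let sfi p : sch (fun q => complex.Im (f p q)).
Proof. by have /schwartz_sch[] := sf p. Qed.

Let chainr p : (p < h)%N -> forall q,
  p.+1%:R * lower (fun t => complex.Re (f p.+1 t)) q =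
  (h - p)%:R * raise (fun t => complex.Re (f p t)) q.
Proof.
by move=> ph q; rewrite -Re_clower -Re_craise -!Re_natM chain.
Qed.

Let chaini p : (p < h)%N -> forall q,
  p.+1%:R * lower (fun t => complex.Im (f p.+1 t)) q =
  (h - p)%:R * raise (fun t => complex.Im (f p t)) q.
Proof.
by move=> ph q; rewrite -Im_clower -Im_craise -!Im_natM chain.
Qed.

Lemma spin_coord_eq0 N : ~~ chain_index h N -> spin_coord N = 0.
Proof.
move=> hN; rewrite /spin_coord (chain_coef_eq0 sfr chainr hN).
by rewrite (chain_coef_eq0 sfi chaini hN).
Qed.

Let ReB (a b : C) : @complex.Re R (a - b) = @complex.Re R a - @complex.Re R b.
Proof. exact: raddfB. Qed.

Let ImB (a b : C) : @complex.Im R (a - b) = @complex.Im R a - @complex.Im R b.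
Proof. exact: raddfB. Qed.

Let Re_sum (I : Type) (r : seq I) (F : I -> C) :
  @complex.Re R (\sum_(i <- r) F i) = \sum_(i <- r) @complex.Re R (F i).
Proof. exact: raddf_sum. Qed.

Let Im_sum (I : Type) (r : seq I) (F : I -> C) :
  @complex.Im R (\sum_(i <- r) F i) = \sum_(i <- r) @complex.Im R (F i).
Proof. exact: raddf_sum. Qed.

Definition spin_part M p q : C := \sum_(N < M) spin_coord N * (spin_coef h N p q)%:C.

Lemma zform_spin_part M :
  zform h (spin_part M) = \sum_(N < M) spin_coord N *: spin h N.
Proof.
apply/funext => x; apply/funext => y; apply/funext => q.
rewrite spinor_sumE /zform /spin_part; under eq_bigr do rewrite big_distrl /=.
rewrite exchange_big /=; apply: eq_bigr => N _.
transitivity (spin_coord N * spin h N x y q) => //; rewrite /spin /zform big_distrr /=.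
by apply: eq_bigr => p _; rewrite mulrA.
Qed.

Let sch_null_hrem d (g : R -> R) : sch g ->
  sch_null (fun M q => hpart (M - d) g q - g q).
Proof.
move=> sg.
have -> : (fun M q => hpart (M - d) g q - g q) = fun M q => -1 * hrem (M - d) g q.
  by apply/funext => M; apply/funext => q; rewrite mulN1r opprB.
apply: sch_nullZ; split=> [M|a b e e0]; first exact: sch_hrem.
have [N _ HN] := hermite_expansion_cvg a b sg e0.
exists (N + d)%N => // M /= NM; apply: HN.
by rewrite /= leq_subRL ?(leq_trans (leq_addl N d))// addnC.
Qed.

Lemma spin_part_null p : (p <= h)%N -> schwartz_null (fun M q => spin_part M p q - f p q).
Proof.
move=> ph; split.
  rewrite (_ : (fun M q => _) = fun M q =>
      hpart (M - 2 * (h - p)) (fun t => complex.Re (f p t)) q - complex.Re (f p q)).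
    exact: sch_null_hrem.
  apply/funext => M; apply/funext => q; rewrite ReB; congr (_ - _).
  rewrite (hpart_chain sfr chainr)// /spin_part Re_sum; apply: eq_bigr => N _.
  by rewrite ReM /= mulr0 subr0.
rewrite (_ : (fun M q => _) = fun M q =>
    hpart (M - 2 * (h - p)) (fun t => complex.Im (f p t)) q - complex.Im (f p q)).
  exact: sch_null_hrem.
apply/funext => M; apply/funext => q; rewrite ImB; congr (_ - _).
rewrite (hpart_chain sfi chaini)// /spin_part Im_sum; apply: eq_bigr => N _.
by rewrite ImM /= mulr0 add0r.
Qed.

End Approximation.

Lemma spin_sum_cvg H f (B : set (spinor R)) : (forall h p, schwartz (f h p)) ->
  Dirac (zsum H f) = 0 -> nbhs (zsum H f) B ->
  exists M, B (\sum_(h < H) \sum_(N < M) spin_coord h (f h) N *: spin h N).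
Proof.
move=> sf /(Dirac_zsum_eq0 _ sf) chain [K [e [e0 KB]]].
have [m mE] := zsum_pol_spinor R.
pose g M h p q := spin_part h (f h) M p q - f h p q.
pose c M i j := if (i + j < H)%N
    then fun q => \sum_(p < (i + j).+1) m (i + j)%N p i * g M (i + j)%N p q
    else fun=> 0.
have gnull h p : (h < H)%N -> (p <= h)%N -> schwartz_null (fun M => g M h p).
  by move=> hH ph; apply: spin_part_null => // p' q ph'; exact: chain.
have cnull i j : schwartz_null (fun M => c M i j).
  rewrite /c; case: ltnP => ijH; last exact: schwartz_null0.
  apply: schwartz_null_sum => p; apply: schwartz_nullZ.
  by apply: gnull => //; rewrite -ltnS.
(* The order [K i j] may vary with the monomial, but the error lives on [i, j < H]; one bound [L]
   leaves finitely many seminorms and hence a common [M]. *)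
pose L := (\max_(i < H) \max_(j < H) K i j)%N.
have : \forall M \near \oo, forall (i j : 'I_H) (a b : 'I_L.+1),
    (schwartz_norm a b (c M i j) < (e i j)%:E)%E.
  apply: filter_forall => i; apply: filter_forall => j.
  apply: filter_forall => a; apply: filter_forall => b.
  by apply: schwartz_null_norm.
move=> [M _ /(_ M (leqnn M)) cM]; exists M.
have -> : \sum_(h < H) \sum_(N < M) spin_coord h (f h) N *: spin h N =
    zsum H (fun h => spin_part h (f h) M).
  apply/funext => x; apply/funext => y; apply/funext => q.
  by rewrite spinor_sumE; apply: eq_bigr => h _; rewrite -zform_spin_part.
apply: KB.
have -> : zsum H (fun h => spin_part h (f h) M) - zsum H f = zsum H (g M).
  apply/funext => x; apply/funext => y; apply/funext => q.
  transitivity (zsum H (fun h => spin_part h (f h) M) x y q - zsum H f x y q) => //.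
  rewrite /zsum -sumrB; apply: eq_bigr => h _.
  by rewrite /zform -sumrB; apply: eq_bigr => p _; rewrite mulrBl.
have sc i j : schwartz (c M i j).
  have [[sr _] [si _]] := cnull i j; apply/schwartz_sch.
  by split; [exact: sr|exact: si].
exists H, (c M); split=> // i j a b aK bK.
have [ijH|ijH] := ltnP (i + j) H; last first.
  by rewrite /c ltnNge ijH /= schwartz_norm0 lte_fin.
have iH : (i < H)%N by lia.
have jH : (j < H)%N by lia.
have KL : (K i j <= L)%N.
  apply: leq_trans (leq_bigmax (Ordinal iH)).
  exact: (leq_bigmax (F := fun j : 'I_H => K i j) (Ordinal jH)).
have aL : (a < L.+1)%N by rewrite ltnS (leq_trans aK).
have bL : (b < L.+1)%N by rewrite ltnS (leq_trans bK).
exact: (cM (Ordinal iH) (Ordinal jH) (Ordinal aL) (Ordinal bL)).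
Qed.

End Solutions.

(** * Freeness and density *)

Section Families.
Variable R : realType.
Local Notation C := R[i].
Local Notation herm := (@herm R).
Implicit Types (x y q : R).

(** Truncated sums run over all pairs [(h, N)], whereas a family contains only some of the chains;
    the others must carry coefficient 0. *)
Lemma linear_span_reindex (K : nzRingType) (E : lmodType K) (I : Type) (T : eqType)
    (b : I -> E) (r : seq T) (c : T -> K) (e : T -> E) :
  (exists phi : I -> T, forall t, t \in r ->
    c t = 0 \/ exists2 i, phi i = t & b i = e t) ->
  linear_span b (\sum_(t <- r) c t *: e t).
Proof.
move=> [phi ce].
suff [s sE] : exists s : seq I, \sum_(t <- r) c t *: e t = \sum_(i <- s) c (phi i) *: b i.
  by exists s, (c \o phi).
elim: r ce => [|t r IHr] ce; first by exists [::]; rewrite !big_nil.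
have [s sE] : exists s : seq I, \sum_(t <- r) c t *: e t = \sum_(i <- s) c (phi i) *: b i.
  by apply: IHr => u ur; apply: ce; rewrite inE ur orbT.
have [ct0|[i it bi]] := ce t (mem_head _ _).
  by exists s; rewrite big_cons ct0 scale0r add0r.
by exists (i :: s); rewrite !big_cons it bi sE.
Qed.

Lemma herm_free (I : eqType) (s : seq I) (N : I -> nat) (a : I -> R) : uniq s ->
  {in s &, injective N} -> (forall q, \sum_(i <- s) a i * herm (N i) q = 0) ->
  {in s, forall i, a i = 0}.
Proof.
move=> us NI s0 i si.
have : dot (herm (N i)) (fun q => \sum_(j <- s) a j * herm (N j) q) = 0.
  rewrite (_ : (fun q => _) = fun=> 0); last by apply/funext => q; exact: s0.
  by rewrite dotC dot0l//; exact: sch_herm.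
rewrite dot_sumr; [|by move=> j; apply: schZ; exact: sch_herm|exact: sch_herm].
rewrite (bigD1_seq i)//= big_seq_cond big1 => [|j /andP[sj ji]]; last first.
  rewrite dotC dotZl; try exact: sch_herm.
  rewrite dot_herm; case: eqP => [E|_]; last by rewrite mulr0.
  by move: ji; rewrite (NI _ _ sj si E) eqxx.
rewrite addr0 dotC dotZl; try exact: sch_herm.
rewrite dot_herm eqxx => /eqP; rewrite mulf_eq0 (negbTE (hnorm_neq0 _ _)) orbF.
by move=> /eqP.
Qed.

Variables (I : eqType) (phi : I -> nat * nat).
Local Notation b := (fun i => @spin R (phi i).1 (phi i).2).

(** Degrees separate by [zsum_free]. Within degree [h], the coefficient of [z^h] in the spinor of
    index [N] is [gam N * herm N], and the indices [N] are distinct. *)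
Lemma spin_free : injective phi -> linearly_independent b.
Proof.
move=> phiI s c us s0.
pose H := (\max_(i <- s) (phi i).1).+1.
have sH i : i \in s -> ((phi i).1 < H)%N.
  by move=> si; rewrite ltnS; exact: leq_bigmax_seq.
pose g h p q : C := \sum_(i <- s | (phi i).1 == h) c i * (spin_coef h (phi i).2 p q)%:C.
have g0 : zsum H g = 0.
  rewrite -[RHS]s0; apply/funext => x; apply/funext => y; apply/funext => q.
  rewrite spinor_sumE.
  transitivity (\sum_(i <- s) \sum_(h < H | h == (phi i).1 :> nat)
      c i * zform h (fun p q => (spin_coef h (phi i).2 p q)%:C) x y q).
    rewrite (exchange_big_dep xpredT) //=; apply: eq_bigr => h _.
    transitivity (\sum_(p < h.+1) \sum_(i <- s | (phi i).1 == h)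
        c i * (spin_coef h (phi i).2 p q)%:C * zpol h p x y).
      by apply: eq_bigr => p _; rewrite /g big_distrl.
    rewrite exchange_big /=; apply: eq_big => i; first by rewrite eq_sym.
    move=> _; rewrite /zform big_distrr /=; apply: eq_bigr => p _.
    by rewrite -(mulrA (c i)).
  rewrite big_seq [RHS]big_seq; apply: eq_bigr => i si.
  by rewrite (big_pred1 (Ordinal (sH i si))).
move=> i0 si0; set h := (phi i0).1.
have cg q : \sum_(i <- s | (phi i).1 == h)
    c i * (gam R (phi i).2 * herm (phi i).2 q)%:C = 0.
  have := zsum_free g0 q (sH _ si0) (leqnn h); rewrite /g -/h => gE.
  rewrite -[RHS]gE; apply: eq_bigr => i _.
  by rewrite /spin_coef subnn muln0 leq0n subn0 binn mul1r.
pose s' := [seq i <- s | (phi i).1 == h].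
have us' : uniq s' by rewrite filter_uniq.
have s'0 : i0 \in s' by rewrite mem_filter eqxx.
have NI : {in s' &, injective (fun i => (phi i).2)}.
  move=> i j; rewrite !mem_filter => /andP[/eqP ih _] /andP[/eqP jh _] ij.
  apply: phiI.
  by rewrite (surjective_pairing (phi i)) (surjective_pairing (phi j)) ih jh ij.
have gn0 : gam R (phi i0).2 != 0 by rewrite gt_eqF// gam_gt0.
apply: eqC_ReIm => /=.
  apply: (mulIf gn0); rewrite mul0r.
  apply: (@herm_free _ s' _ (fun i => complex.Re (c i) * gam R (phi i).2))
    us' NI _ _ s'0 => q.
  rewrite big_filter; have := congr1 (@complex.Re R) (cg q).
  rewrite (raddf_sum (@complex.Re R)) /= => cE; rewrite -[RHS]cE.
  by apply: eq_bigr => i _; rewrite ReM /= mulr0 subr0 mulrA.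
apply: (mulIf gn0); rewrite mul0r.
apply: (@herm_free _ s' _ (fun i => complex.Im (c i) * gam R (phi i).2))
    us' NI _ _ s'0 => q.
rewrite big_filter; have := congr1 (@complex.Im R) (cg q).
rewrite (raddf_sum (@complex.Im R)) /= => cE; rewrite -[RHS]cE.
by apply: eq_bigr => i _; rewrite ImM /= mulr0 add0r mulrA.
Qed.

(** The family has to cover only the chains occurring in the given solution, so one lemma serves the
    odd part, the even part and the whole kernel. *)
Lemma spin_dense H f : (forall h p, schwartz (f h p)) -> Dirac (zsum H f) = 0 ->
  (forall h N, (h < H)%N -> spin_coord h (f h) N != 0 -> exists i, phi i = (h, N)) ->
  closure (linear_span b) (zsum H f).
Proof.
move=> sf f0 cphi B /(spin_sum_cvg sf f0)[M BM]; eexists; split; last exact: BM.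
rewrite pair_bigA /=.
pose e (t : nat * nat) := @spin R t.1 t.2.
pose c (t : nat * nat) := spin_coord t.1 (f t.1) t.2.
pose r := [seq (val t.1, val t.2) | t <- index_enum ('I_H * 'I_M)%type].
rewrite (_ : \sum_(_ | _) _ = \sum_(t <- r) c t *: e t); last first.
  by rewrite big_map; apply: eq_bigr.
apply: linear_span_reindex.
exists phi => t /mapP[[h N] _ ->] /=; rewrite /c /=.
have [->|/cphi] := eqVneq (spin_coord h (f h) N) 0; first by left.
by move=> /(_ (ltn_ord h))[i iE]; right; exists i; rewrite ?iE.
Qed.

End Families.

(** * Identification with the spinors of the theorem; parity *)

Section Identification.
Variable R : realType.
Local Notation C := R[i].
Local Notation herm := (@herm R).
Implicit Types (x y q : R).

Lemma gam_herm n q : gam R n * herm n q =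
  Num.sqrt ((dfactn n.-1)%:R / (dfactn n)%:R) * hermite_fun n q.
Proof. by rewrite hermite_funE mulrA. Qed.

Lemma s_oddE h k : s_odd h k = @spin R h (2 * k + 2 * h + 1).
Proof.
apply/funext => x; apply/funext => y; apply/funext => q.
rewrite /s_odd big_mkord; apply: eq_bigr => p _; have ph := ltn_ord p.
rewrite /spin_coef (_ : (2 * (h - p) <= 2 * k + 2 * h + 1)%N); last by lia.
rewrite (_ : 2 * k + 2 * h + 1 - 2 * (h - p) = 2 * k + 2 * p + 1)%N; last by lia.
rewrite -[in RHS]mulrA gam_herm.
rewrite (_ : (2 * k + 2 * p + 1).-1 = 2 * k + 2 * p)%N; last by lia.
by congr (_%:C * _); rewrite /dfact; ring.
Qed.

Lemma s_evenE h (k : int) : - h%:Z <= k ->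
  s_even h k = @spin R h (absz (2 * k + 2 * h%:Z)).
Proof.
move=> hk; apply/funext => x; apply/funext => y; apply/funext => q.
rewrite /s_even big_geq_mkord big_mkcond; apply: eq_bigr => p _ /=.
have ph := ltn_ord p; rewrite /spin_coef.
set a := (if _ then 0%N else absz k); set N := absz (2 * k + 2 * h%:Z).
(* For negative [k] the range [p >= |k|] is exactly where the Hermite index [2k + 2p] is
   nonnegative. *)
have aE : (a <= p)%N = (2 * (h - p) <= N)%N.
  by rewrite /a /N; case: ifP; lia.
rewrite aE; case: ifPn => [hN|_]; last by rewrite mul0r.
have nE : 2 * k + 2 * p%:Z = (N - 2 * (h - p))%N%:Z by rewrite /N in hN *; lia.
rewrite nE absz_nat; set n := (N - _)%N.
rewrite -[in RHS]mulrA gam_herm.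
(* At [n = 0] the convention [(-1)!! = 1] agrees with the truncated predecessor, as [0!! = 1]. *)
have -> : dfact (n%:Z - 1) = dfactn n.-1.
  by case: (n) => // m; rewrite (_ : m.+1%:Z - 1 = m%:Z)//; lia.
by congr (_%:C * _); rewrite /dfact; ring.
Qed.

Lemma herm_opp n q : herm n (- q) = (-1) ^+ n * herm n q.
Proof.
elim: n q => [|n IHn] q; first by rewrite /= /gaussian sqrrN expr0 mul1r.
have dE : derive1 (herm n) (- q) = - ((-1) ^+ n * derive1 (herm n) q).
  have d1 := deriv_opp (sch_deriv (@sch_herm R n)).
  have d2 := derivZ ((-1) ^+ n) (sch_deriv (@sch_herm R n)).
  have E : (fun x => herm n (- x)) = fun x => (-1) ^+ n * herm n x by apply/funext.
  have := derivE d1; rewrite E (derivE d2) => /(congr1 (@^~ q)) /= ->.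
  by rewrite opprK.
by rewrite /= /raise dE IHn exprS; ring.
Qed.

(** All Hermite indices along a chain have the parity of [N]. *)
Lemma spin_opp h N x y q : spin h N x y (- q) = (-1) ^+ N * spin h N x y q.
Proof.
rewrite /spin /zform big_distrr /=; apply: eq_bigr => p _.
rewrite (mulrA ((-1) ^+ N)); congr (_ * _).
rewrite /spin_coef; case: ifP => [hN|_]; last by rewrite rmorph0 mulr0.
have -> : (-1) ^+ N = ((-1) ^+ (N - 2 * (h - p)))%:C :> C.
  rewrite -[in LHS](subnK hN) exprD exprM sqrrN !expr1n mulr1.
  by rewrite rmorphXn /= rmorphN1.
by rewrite herm_opp -rmorphM; congr (_%:C); ring.
Qed.

Lemma hcoef_parity (f : R -> R) (s : R) N : sch f -> (forall q, f (- q) = s * f q) ->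
  s * (-1) ^+ N = -1 -> hcoef f N = 0.
Proof.
move=> sf fs sN; rewrite /hcoef.
have := dot_opp sf (@sch_herm R N).
have -> : (fun x => f (- x)) = fun x => s * f x by apply/funext.
have -> : (fun x => herm N (- x)) = fun x => (-1) ^+ N * herm N x.
  by apply/funext => x; exact: herm_opp.
rewrite dotZl//; last by apply: schZ; exact: sch_herm.
rewrite dotC dotZl//; last exact: sch_herm.
rewrite mulrA sN dotC => E; suff -> : dot f (herm N) = 0 by rewrite mul0r.
lra.
Qed.

Lemma spin_coord_parity h f (s : R) N : (forall p, schwartz (f p)) ->
  (forall x y q, zform h f x y (- q) = s%:C * zform h f x y q) ->
  s * (-1) ^+ N = -1 -> spin_coord h f N = 0.
Proof.
move=> sf fs sN.
(* Parity of the spinor passes to its coefficients by freeness; [p = h] is the one from which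
   [spin_coord] is read. *)
have fh q : f h (- q) = s%:C * f h q.
  apply/eqP; rewrite -subr_eq0; apply/eqP.
  pose g p q := f p (- q) - s%:C * f p q.
  have := @zsum_free R h.+1 (single h g) _ h h q (ltnSn h) (leqnn h).
  rewrite {2}/single eqxx; apply; rewrite -zform_zsum.
  apply/funext => x; apply/funext => y; apply/funext => t.
  transitivity (zform h f x y (- t) - s%:C * zform h f x y t); last first.
    by rewrite fs subrr.
  rewrite /zform big_distrr /= -sumrB; apply: eq_bigr => p _.
  by rewrite /g mulrBl mulrA.
have [sr si] := (schwartz_sch _).1 (sf h).
rewrite /spin_coord /chain_coef (@hcoef_parity _ s)//; last first.
  by move=> q; rewrite fh ReM /= mul0r subr0.
rewrite (@hcoef_parity _ s)// ?mul0r//.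
by move=> q; rewrite fh ImM /= mul0r addr0.
Qed.

Lemma spin_coord0 h N : spin_coord h (fun _ _ => 0 : C) N = 0.
Proof.
rewrite /spin_coord /chain_coef /hcoef dot0l ?mul0r//; exact: sch_herm.
Qed.

Lemma monogenic_zsum h (u : spinor R) : monogenic h u ->
  exists f, [/\ forall p, schwartz (f p), u = zform h f,
    u = zsum h.+1 (single h f) & Dirac (zsum h.+1 (single h f)) = 0].
Proof.
move=> [/Polh_S_zform[f [sf uE]] [_ Du]]; exists f.
by split; rewrite -?zform_zsum -?uE.
Qed.

Lemma spin_coord_single h (f : nat -> R -> C) h' N :
  spin_coord h' (single h f h') N != 0 ->
  h' = h /\ spin_coord h f N != 0.
Proof.
have [->|hh'] := eqVneq h' h.
  by have -> : single h f h = f by apply/funext => p; rewrite /single eqxx.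
have -> : single h f h' = fun _ _ => 0.
  by apply/funext => p; rewrite /single (negbTE hh').
by rewrite spin_coord0 eqxx.
Qed.

Lemma spin_coord_index h (f : nat -> R -> C) N : (forall p, schwartz (f p)) ->
  Dirac (zsum h.+1 (single h f)) = 0 -> spin_coord h f N != 0 -> chain_index h N.
Proof.
move=> sf /(Dirac_zsum_eq0 _ (schwartz_single h sf)) chain.
apply: contraNT => hN; apply/eqP; apply: spin_coord_eq0 hN => // p q ph.
by have := chain h p q (ltnSn h) ph; rewrite /single eqxx.
Qed.

End Identification.

Theorem proposition6p2 (R : realType) :
  (forall h : nat,
     topological_basis (monogenic h `&` odd_in_q (R := R)) (s_odd (R := R) h)) /\
  (forall h : nat,
     topological_basis (monogenic h `&` even_in_q (R := R))
       (fun k : even_index h => s_even (R := R) h (val k))) /\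
  topological_basis (Ker_Dirac (R := R)) (s_all (R := R)).
Proof.
have index_odd h k : chain_index h (2 * k + 2 * h + 1) by rewrite /chain_index; lia.
have index_even h (k : int) : - h%:Z <= k -> chain_index h (absz (2 * k + 2 * h%:Z)).
  by move=> hk; rewrite /chain_index; lia.
split; [move=> h|split; [move=> h|]].
- pose phi (k : nat) := (h, (2 * k + 2 * h + 1)%N).
  have sE : s_odd h = fun k => @spin R (phi k).1 (phi k).2.
    by apply/funext => k; exact: s_oddE.
  rewrite sE; split.
  + move=> k; split; first exact/spin_monogenic/index_odd.
    by move=> x y q; rewrite spin_opp /= -signr_odd (_ : odd _) ?mulN1r//; lia.
  + by apply: spin_free => k l []; lia.
  + move=> u [/monogenic_zsum[f [sf uf uE D0]] uo]; rewrite uE.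
    apply: spin_dense => //; first exact: schwartz_single.
    move=> h' N _ /spin_coord_single[-> cN].
    have iN := spin_coord_index sf D0 cN.
    have oN : odd N.
      apply: contraNT cN => eN; apply/eqP.
      apply: (@spin_coord_parity _ _ _ (-1)) => //.
        by move=> x y q; rewrite -uf uo rmorphN1 mulN1r.
      by rewrite -signr_odd (negbTE eN) mulr1.
    (* Inverse of [k |-> 2k + 2h + 1]; for odd [N], [chain_index] gives [N > 2h], so the
       subtractions are exact. *)
    exists ((N - 2 * h - 1)./2)%N; congr pair.
    by move: iN; rewrite /chain_index; lia.
- pose phi (k : even_index h) := (h, absz (2 * val k + 2 * h%:Z)).
  have sE : (fun k : even_index h => s_even h (val k)) =
      fun k => @spin R (phi k).1 (phi k).2.
    by apply/funext => k; exact: (s_evenE R (valP k)).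
  rewrite sE; split.
  + move=> k; split; first exact/spin_monogenic/index_even/(valP k).
    by move=> x y q; rewrite spin_opp /= -signr_odd (_ : odd _ = false) ?mul1r//; lia.
  + by apply: spin_free => -[k hk] [l hl] [] /= kl; apply: val_inj => /=; lia.
  + move=> u [/monogenic_zsum[f [sf uf uE D0]] ue]; rewrite uE.
    apply: spin_dense => //; first exact: schwartz_single.
    move=> h' N _ /spin_coord_single[-> cN].
    have eN : ~~ odd N.
      apply: contraNN cN => oN; apply/eqP.
      apply: (@spin_coord_parity _ _ _ 1) => //.
        by move=> x y q; rewrite -uf ue rmorph1 mul1r.
      by rewrite -signr_odd oN mul1r.
    (* Inverse of [k |-> 2k + 2h]: the even [N] below [2h] are the negative [k] down to [-h]. *)
    have kh : - h%:Z <= N./2%:Z - h%:Z by lia.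
    exists (exist _ (N./2%:Z - h%:Z) kh); congr pair => /=; lia.
- pose phi (i : {h : nat & (nat + even_index h)%type}) : nat * nat :=
    (tag i, match tagged i with
            | inl k => (2 * k + 2 * tag i + 1)%N
            | inr k => absz (2 * val k + 2 * (tag i)%:Z)
            end).
  have sE : s_all (R := R) = fun i => @spin R (phi i).1 (phi i).2.
    apply/funext => -[h [k|k]]; rewrite /s_all /=; first exact: s_oddE.
    exact: (s_evenE R (valP k)).
  rewrite sE; split.
  + move=> [h [k|k]].
      by have [_] := spin_monogenic R (index_odd h k).
    by have [_] := spin_monogenic R (index_even h _ (valP k)).
  + apply: spin_free => -[h k] [h' k'] [] hh; subst h'.
    (* In the mixed cases an odd chain index would equal an even one. *)
    case: k k' => [k|[k hk]] [k'|[k' hk']] /= kk; [|lia|lia|].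
      by have -> : k = k' by lia.
    have -> // : exist _ k hk = exist _ k' hk' :> even_index h.
    by apply: val_inj => /=; lia.
  + move=> u [/Pol_S_zsum[H [f [sf ->]]] D0]; apply: spin_dense => //.
    move=> h N hH cN; have iN : chain_index h N.
      apply: contraNT cN => hN; apply/eqP; apply: spin_coord_eq0 hN => // p q ph.
      exact: (Dirac_zsum_eq0 H sf).1.
    (* Every admissible chain belongs to one of the two families according to the parity of [N], so
       the kernel is treated without splitting it. *)
    have [oN|eN] := boolP (odd N).
      exists (existT _ h (inl (N - 2 * h - 1)./2)); congr pair => /=.
      by move: iN; rewrite /chain_index; lia.
    have kh : - h%:Z <= N./2%:Z - h%:Z by lia.
    exists (existT _ h (inr (exist _ (N./2%:Z - h%:Z) kh))); congr pair => /=; lia.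
Qed.
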